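(* Consider the uncertain closed-loop system (without disturbance) $$\dot x(t)=(\mathcal{A}(\theta)+L_fK_f\bar C)x(t)+(\mathcal{B}(\theta)+LE)\varphi(y_f(t)),\qquad y_f(t)=Cx(t),\qquad (\ast)$$ with state $x(t)\in\mathbb{R}^n$, unknown parameter $\theta\in\Theta$, $\mathcal{A}(\theta)=\sum_{i=1}^{n_\alpha}\alpha_i(\theta)A_i$, $\mathcal{B}(\theta)=\sum_{i=1}^{n_\alpha}\alpha_i(\theta)B_i$, and all data as defined in the context, where $K_f\in\mathbb{R}^{n_f\times n_f}$ and $E\in\mathbb{R}^{(n_c+n_f)\times m_a}$ are gains to be designed. Let $\bar C^{\perp}\in\mathbb{R}^{n\times(n_p+n_c)}$ be a matrix such that $\bar C\,\bar C^{\perp}=0$. Assume there exist $n_\alpha$ symmetric positive definite matrices $\bar P_i\in\mathbb{R}^{n\times n}$, $i=1,\dots,n_\alpha$, matrices $J_o\in\mathbb{R}^{(n_p+n_c)\times(n_p+n_c)}$, $J_f\in\mathbb{R}^{n_f\times n}$, $\bar K_f\in\mathbb{R}^{n_f\times n_f}$, $K_e\in\mathbb{R}^{(n_c+n_f)\times m_a}$, $\bar G\in\mathbb{R}^{m_a\times n}$, a diagonal positive definite matrix $S\in\mathbb{R}^{m_a\times m_a}$, and a positive scalar $\gamma$ such that, with $$\bar J=\begin{bmatrix}\bar C^{\perp}J_o^{\top} & J_f^{\top}\end{bmatrix}^{\top}\in\mathbb{R}^{n\times n},\qquad Z=\mathrm{diag}(0_{n_p+n_c},\bar K_f),$$ $$\Psi_{12_i}=\bar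 P_i+A_i\bar J^{\top}+Z-\bar J,\quad \Psi_{13_i}=B_iS+LK_e,\quad \Psi_{22_i}=\mathrm{He}\{A_i\bar J^{\top}+Z\},\quad \Psi_{23_i}=\Psi_{13_i}-\bar G^{\top}-\bar J C^{\top},$$ the following conditions hold for all $i\in\{1,\dots,n_\alpha\}$: $$\begin{bmatrix}-\bar J-\bar J^{\top}&\Psi_{12_i}&\Psi_{13_i}&0\\ \star&\Psi_{22_i}&\Psi_{23_i}&\bar J C^{\top}W^{1/2}\\ \star&\star&-2S&SW^{1/2}\\ \star&\star&\star&-\gamma I\end{bmatrix}\prec 0,$$ $$\begin{bmatrix}\bar P_i&\bar G_{(j)}^{\top}\\ \star&\bar u_{(j)}^2\end{bmatrix}\succeq 0\quad\text{for } j=1,\dots,m_a.$$ Then the gains $E=\begin{bmatrix}E_c^{\top}&E_f^{\top}\end{bmatrix}^{\top}=K_eS^{-1}$ and $K_f=\bar K_f(\bar C J_f^{\top})^{-1}$ are such that, for any $\theta\in\Theta$: 1. the closed-loop system $(\ast)$ is asymptotically stable in the ellipsoid $\varepsilon(P(\theta),1)=\{x\in\mathbb{R}^n:\ x^{\top}P(\theta)x\le 1\}$, with $P(\theta)=\sum_{i=1}^{n_\alpha}\alpha_i(\theta)P_i$, $P_i=J\bar P_iJ^{\top}$ and $J=\bar J^{-1}$; 2. the energy of the actuators usage signal is limited and given by $$\int_0^{\infty}\mathrm{sat}(y_f(\tau))^{\top}W\,\mathrm{sat}(y_f(\tau))\,d\tau\le\gamma.$$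
   Context: Notation. $Y_{(i)}$ is the $i$th row of a matrix $Y$ and $v_{(i)}$ the $i$th component of a vector $v$. For symmetric matrices, $\succ,\succeq,\prec$ denote the usual (semi)definite orders. $\star$ denotes blocks determined by symmetry. $\mathrm{He}\{X\}=X+X^{\top}$. $\mathrm{diag}(\cdot,\cdot)$ is block-diagonal; $0_k$ is the $k\times k$ zero matrix; $I$ is an identity matrix and $0$ a null matrix of appropriate size. Saturation and deadzone. For given bounds $\bar u_{(i)}>0$, $i=1,\dots,m_a$, and $s\in\mathbb{R}^{m_a}$, $\mathrm{sat}(s)$ is defined componentwise by $\mathrm{sat}(s_{(i)})=\mathrm{sign}(s_{(i)})\min\{|s_{(i)}|,\bar u_{(i)}\}$, and $\varphi(s)=\mathrm{sat}(s)-s$. Uncertain influence matrix. $M(\theta)=M_n+M_u(\theta)\in\mathbb{R}^{m_c\times m_a}$, $m_a>m_c$, of full row rank, with $M_n$ known and $\theta$ an unknown bounded vector parameter lying in a convex polytope $\Theta\subset\mathbb{R}^r$. It is assumed that, with $n_\alpha=2^r$, there are parameters $\alpha_i(\theta)$, $i=1,\dots,n_\alpha$, with $\alpha_i(\theta)\ge0$ and $\sum_{i=1}^{n_\alpha}\alpha_i(\theta)=1$, and matrices $M_i\in\mathbb{R}^{m_c\times m_a}$, such that $M_u(\theta)=\sum_{i=1}^{n_\alpha}\alpha_i(\theta)M_i$. $M^{\dagger}$ is the right pseudo-inverse of $M_n$ ($M_nM^{\dagger}=I$); $n_f=m_a-m_c$; the columns of $N\in\mathbb{R}^{m_a\times n_f}$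 form a basis of $\ker M_n$. Subsystems. Plant: $\dot x_p=A_px_p+B_pu_p$, $y_p=C_px_p$, with $x_p\in\mathbb{R}^{n_p}$, $u_p\in\mathbb{R}^{m_c}$, $y_p\in\mathbb{R}^{q}$; $(A_p,B_p)$ is controllable and $(C_p,A_p)$ observable; $u_p=M(\theta)\,\mathrm{sat}(y_f)$. Controller: $\dot x_c=A_cx_c+B_cy_p+E_c\varphi(y_f)$, $y_c=C_cx_c+D_cy_p$, with $x_c\in\mathbb{R}^{n_c}$, $y_c\in\mathbb{R}^{m_c}$, $E_c\in\mathbb{R}^{n_c\times m_a}$. Dynamic allocator: $\dot x_f=K_fN^{\top}WNx_f+K_fN^{\top}WM^{\dagger}y_c+E_f\varphi(y_f)$, $y_f=Nx_f+M^{\dagger}y_c$, with $x_f\in\mathbb{R}^{n_f}$, $E_f\in\mathbb{R}^{n_f\times m_a}$, and $W\in\mathbb{R}^{m_a\times m_a}$ a given diagonal positive definite weighting matrix. Closed-loop data. $x=[x_p^{\top}\ x_c^{\top}\ x_f^{\top}]^{\top}\in\mathbb{R}^n$, $n=n_p+n_c+n_f$; $$A_0=\begin{bmatrix}A_p+B_pD_cC_p&B_pC_c\\ B_cC_p&A_c\end{bmatrix},\quad A=\begin{bmatrix}A_0&0\\ 0&0_{n_f}\end{bmatrix},\quad \bar B=\begin{bmatrix}B_p\\ 0\end{bmatrix}\in\mathbb{R}^{n\times m_c},\quad B=\bar BM_n,$$ $$C=\begin{bmatrix}M^{\dagger}D_cC_p&M^{\dagger}C_c&N\end{bmatrix},\quad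 \bar C=N^{\top}WC,\quad A_i=A+\bar BM_iC,\quad B_i=B+\bar BM_i\quad(i=1,\dots,n_\alpha),$$ $$E=\begin{bmatrix}E_c\\ E_f\end{bmatrix},\quad L=\begin{bmatrix}L_c&L_f\end{bmatrix},\quad L_c=\begin{bmatrix}0_{n_c\times n_p}&I_{n_c}&0_{n_c\times n_f}\end{bmatrix}^{\top},\quad L_f=\begin{bmatrix}0_{n_f\times n_p}&0_{n_f\times n_c}&I_{n_f}\end{bmatrix}^{\top}.$$ Standing assumption: $A_0$ is Hurwitz. ''Asymptotically stable in the ellipsoid $\varepsilon(P(\theta),1)$'' means that the origin is asymptotically stable and $\varepsilon(P(\theta),1)$ is contained in its basin of attraction. *)

(* Defs.v *)
From mathcomp Require Export all_boot all_order all_algebra.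
From mathcomp Require Export all_classical all_reals all_analysis.
From mathcomp Require Export complex.
Export Order.TTheory GRing.Theory Num.Theory numFieldNormedType.Exports.

Set Implicit Arguments.
Unset Strict Implicit.
Unset Printing Implicit Defensive.

#[export] Set Implicit Arguments.
#[export] Unset Strict Implicit.
#[export] Unset Printing Implicit Defensive.

Global Open Scope classical_set_scope.
Global Open Scope ring_scope.

Section Matrices.
Variable R : realType.

Definition posdef n (A : 'M[R]_n) : Prop :=
  A^T = A /\ forall v : 'cV[R]_n, v != 0 -> 0 < (v^T *m A *m v) 0 0.

Definition possemidef n (A : 'M[R]_n) : Prop :=
  A^T = A /\ forall v : 'cV[R]_n, 0 <= (v^T *m A *m v) 0 0.

Definition negdef n (A : 'M[R]_n) : Prop := posdef (- A).

Definition He n (X : 'M[R]_n) : 'M[R]_n := X + X^T.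

(* [X Y; * Z] *)
Definition star_mx m n (X : 'M[R]_m) (Y : 'M[R]_(m, n)) (Z : 'M[R]_n) :
  'M[R]_(m + n) := block_mx X Y Y^T Z.

(* Entrywise square root.  For W diagonal and positive semidefinite it is the
   diagonal positive semidefinite square root of W (see sqrt_diagK); it is
   meaningful only in that case. *)
Definition sqrt_diag n (W : 'M[R]_n) : 'M[R]_n := map_mx (@Num.sqrt R) W.

Lemma sqrt_diag_diag n (W : 'M[R]_n) : is_diag_mx W -> is_diag_mx (sqrt_diag W).
Proof.
move=> /is_diag_mxP dW; apply/is_diag_mxP => i j ij.
by rewrite mxE dW // sqrtr0.
Qed.

Lemma sqrt_diag_ge0 n (W : 'M[R]_n) i j : 0 <= sqrt_diag W i j.
Proof. by rewrite mxE sqrtr_ge0. Qed.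

Lemma sqrt_diagK n (W : 'M[R]_n) : is_diag_mx W -> possemidef W ->
  sqrt_diag W *m sqrt_diag W = W.
Proof.
move=> /is_diag_mxP dW [_ W0]; apply/matrixP => i j; rewrite mxE.
rewrite (bigD1 i) //= big1 ?addr0; last first.
  by move=> k ki; rewrite !mxE dW ?sqrtr0 ?mul0r // eq_sym.
rewrite !mxE; have [<-|ij] := eqVneq i j; last by rewrite (dW i j) ?sqrtr0 ?mulr0.
rewrite -expr2 sqr_sqrtr //.
have := W0 (delta_mx i 0).
by rewrite trmx_delta -rowE -colE !mxE.
Qed.

Definition hurwitz n (A : 'M[R]_n) : Prop :=
  forall z : R[i], eigenvalue (map_mx (real_complex R) A) z ->
    complex.Re z < 0.

(* ker M is the set of column vectors v with M v = 0, which is the transpose of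
   the row kernel of M^T. *)
Definition cols_basis_ker m n k (M : 'M[R]_(m, n)) (N : 'M[R]_(n, k)) : Prop :=
  row_free N^T /\ (N^T :=: kermx M^T)%MS.

Definition convex_polytope n (Theta : set 'cV[R]_n) : Prop :=
  exists (k : nat) (v : 'I_k -> 'cV[R]_n),
    Theta = [set x | exists c : 'I_k -> R,
      [/\ forall i, 0 <= c i, \sum_i c i = 1 & x = \sum_i c i *: v i]].

Definition ellipsoid n (P : 'M[R]_n) : set 'cV[R]_n :=
  [set x | (x^T *m P *m x) 0 0 <= 1].

Definition sat n (ubar s : 'cV[R]_n) : 'cV[R]_n :=
  \col_i (Num.sg (s i 0) * Num.min `|s i 0| (ubar i 0)).

Definition deadzone n (ubar s : 'cV[R]_n) : 'cV[R]_n := sat ubar s - s.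

End Matrices.

Section Trajectories.
Variable R : realType.

(* v(t) is the two-sided derivative in the interior of the time interval D;
   only continuity is asked at the endpoints. *)
Definition has_velocity n (D : set R) (x v : R -> 'cV[R]_n) : Prop :=
  {within D, continuous x} /\ forall t, D° t -> is_derive t 1 x (v t).

Definition controllable n m (A : 'M[R]_n) (B : 'M[R]_(n, m)) : Prop :=
  forall x0 x1 : 'cV[R]_n, exists (T : R) (u : R -> 'cV[R]_m)
    (x : R -> 'cV[R]_n),
    [/\ 0 < T, {within `[0, T], continuous u},
        has_velocity `[0, T] x (fun t => A *m x t + B *m u t),
        x 0 = x0 & x T = x1].

(* By linearity the unforced response is enough: the input cancels in the
   difference of two responses. *)
Definition observable n q (C : 'M[R]_(q, n)) (A : 'M[R]_n) : Prop :=
  exists2 T : R, 0 < T & forall x x' : R -> 'cV[R]_n,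
    has_velocity `[0, T] x (fun t => A *m x t) ->
    has_velocity `[0, T] x' (fun t => A *m x' t) ->
    (forall t, t \in `[0, T] -> C *m x t = C *m x' t) -> x 0 = x' 0.

Variable n : nat.
Implicit Types (f : 'cV[R]_n -> 'cV[R]_n) (x : R -> 'cV[R]_n).

Definition solution f (x0 : 'cV[R]_n) x : Prop :=
  x 0 = x0 /\ has_velocity `[0, +oo[ x (fun t => f (x t)).

(* The norm below is the library's (maximum) norm on column vectors; stability
   in finite dimension does not depend on the choice of norm. *)
Definition lyapunov_stable f : Prop :=
  forall e : R, 0 < e -> exists2 d : R, 0 < d &
    forall (x0 : 'cV[R]_n) x, `|x0| < d -> solution f x0 x ->
      forall t, 0 <= t -> `|x t| < e.

(* Existence of a solution on [0, +oo[ is part of the definition, so that the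
   convergence requirement is never vacuous. *)
Definition basin f : set 'cV[R]_n :=
  [set x0 | (exists x, solution f x0 x) /\
            forall x, solution f x0 x -> x t @[t --> +oo] --> (0 : 'cV[R]_n)].

Definition asymptotically_stable f : Prop :=
  [/\ f 0 = 0, lyapunov_stable f & nbhs (0 : 'cV[R]_n) (basin f)].

Definition asymptotically_stable_in f (D : set 'cV[R]_n) : Prop :=
  asymptotically_stable f /\ D `<=` basin f.

End Trajectories.

(* Main.v *)
Require Import Defs.
From mathcomp Require Import ring lra measurable_realfun.

(** Write v = f(x) for the velocity, p for the deadzone and s = sat(y_f).
    Evaluating the quadratic form of the first LMI at
    (J^T v, J^T x, S^-1 p, gamma^-1 W^(1/2) s) eliminates J and the Schur
    complement, and the average over the vertices gives, with
    V(x) = x^T P(theta) x,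
      dV/dt - 2 p^T S^-1 (s + G x) + gamma^-1 s^T W s <= - c |J^T x|^2.
    The second LMI says |(G x)_j| <= ubar_j on the ellipsoid, so the sector
    inequality p^T S^-1 (s + G x) <= 0 holds there.  Hence V decays
    exponentially along trajectories, which cannot leave the ellipsoid, and
    integrating s^T W s <= - gamma dV/dt bounds the cost by gamma V(x(0)).
    Global existence of trajectories is Picard iteration, the closed loop being
    globally Lipschitz. *)

(** * Quadratic forms and the matrix inequality *)

Section dot.
Variable R : realType.

Definition dot n (a b : 'cV[R]_n) : R := (a^T *m b) 0 0.

Lemma dotC n (a b : 'cV[R]_n) : dot a b = dot b a.
Proof. by rewrite /dot -[a^T *m b]trmxK trmx_mul trmxK mxE. Qed.

Lemma dotE n (a b : 'cV[R]_n) : dot a b = \sum_i a i 0 * b i 0.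
Proof. by rewrite /dot mxE; apply: eq_bigr => i _; rewrite mxE. Qed.

Lemma dotDl n (a b c : 'cV[R]_n) : dot (a + b) c = dot a c + dot b c.
Proof. by rewrite /dot linearD/= mulmxDl mxE. Qed.

Lemma dotNl n (a c : 'cV[R]_n) : dot (- a) c = - dot a c.
Proof. by rewrite /dot linearN/= mulNmx mxE. Qed.

Lemma dotZl n k (a c : 'cV[R]_n) : dot (k *: a) c = k * dot a c.
Proof. by rewrite /dot linearZ/= -scalemxAl mxE. Qed.

Lemma dotDr n (a b c : 'cV[R]_n) : dot c (a + b) = dot c a + dot c b.
Proof. by rewrite !(dotC c) dotDl. Qed.

Lemma dotNr n (a c : 'cV[R]_n) : dot c (- a) = - dot c a.
Proof. by rewrite !(dotC c) dotNl. Qed.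

Lemma dotZr n k (a c : 'cV[R]_n) : dot c (k *: a) = k * dot c a.
Proof. by rewrite !(dotC c) dotZl. Qed.

Lemma dot0l n (a : 'cV[R]_n) : dot 0 a = 0.
Proof. by rewrite -(scale0r a) dotZl mul0r. Qed.

Lemma dot0r n (a : 'cV[R]_n) : dot a 0 = 0.
Proof. by rewrite dotC dot0l. Qed.

Lemma dot_sumr n (I : finType) (F : I -> 'cV[R]_n) a :
  dot a (\sum_i F i) = \sum_i dot a (F i).
Proof. by rewrite /dot mulmx_sumr summxE. Qed.

Lemma dot_mulmxr m n (a : 'cV[R]_m) (A : 'M[R]_(m, n)) (b : 'cV[R]_n) :
  dot a (A *m b) = dot (A^T *m a) b.
Proof. by rewrite /dot trmx_mul trmxK mulmxA. Qed.

Lemma dot_trmx m n (a : 'cV[R]_m) (A : 'M[R]_(n, m)) (b : 'cV[R]_n) :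
  dot a (A^T *m b) = dot b (A *m a).
Proof. by rewrite dot_mulmxr trmxK dotC. Qed.

Lemma dot_colmx m n (a a' : 'cV[R]_m) (b b' : 'cV[R]_n) :
  dot (col_mx a b) (col_mx a' b') = dot a a' + dot b b'.
Proof. by rewrite /dot tr_col_mx mul_row_col mxE. Qed.

Lemma dot_ge0 n (a : 'cV[R]_n) : 0 <= dot a a.
Proof. by rewrite dotE sumr_ge0// => i _; rewrite -expr2 sqr_ge0. Qed.

Lemma dot_star_mx m n (X : 'M[R]_m) (Y : 'M[R]_(m, n)) (Z : 'M[R]_n)
    (a : 'cV[R]_m) (b : 'cV[R]_n) :
  dot (col_mx a b) (star_mx X Y Z *m col_mx a b) =
  dot a (X *m a) + 2 * dot a (Y *m b) + dot b (Z *m b).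
Proof.
rewrite /star_mx mul_block_col dot_colmx !dotDr (dot_mulmxr b) trmxK.
by rewrite (dotC _ a); ring.
Qed.

Lemma posdefP n (Q : 'M[R]_n) :
  posdef Q <-> Q^T = Q /\ forall v : 'cV[R]_n, v != 0 -> 0 < dot v (Q *m v).
Proof. by split=> -[QT Q0]; split=> // v /Q0; rewrite /dot mulmxA. Qed.

Lemma unitmx_lker0 n (A : 'M[R]_n) :
  (forall u : 'rV[R]_n, u *m A = 0 -> u = 0) -> A \in unitmx.
Proof.
move=> A0; rewrite -row_free_unit -kermx_eq0; apply/eqP/row_matrixP => i.
by rewrite row0; apply: A0; rewrite -row_mul mulmx_ker row0.
Qed.

(** Symmetry is not assumed, so this applies to [Jbar] as well: a left kernel vector would make the
    form vanish at its transpose. *)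
Lemma accretive_unitmx n (A : 'M[R]_n) :
  (forall v : 'cV[R]_n, v != 0 -> 0 < dot v (A *m v)) -> A \in unitmx.
Proof.
move=> A0; apply: unitmx_lker0 => u uA0; apply/eqP; rewrite -trmx_eq0.
apply: contraT => /A0; rewrite dot_mulmxr -trmx_mul uA0 trmx0.
by rewrite dot0l ltxx.
Qed.

Lemma posdef_unitmx n (Q : 'M[R]_n) : posdef Q -> Q \in unitmx.
Proof. by move=> /posdefP[_]; exact: accretive_unitmx. Qed.

(* Cauchy-Schwarz for the form Q bounds each coordinate of v:
   v_i^2 <= (v^T Q v) (Q^-1)_ii. *)
Lemma posdef_coercive n (Q : 'M[R]_n) : posdef Q ->
  exists2 c, 0 < c & forall v : 'cV[R]_n, c * dot v v <= dot v (Q *m v).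
Proof.
move=> Qp; have Qu := posdef_unitmx Qp; case/posdefP: Qp => QT Q0.
have Qge v : 0 <= dot v (Q *m v).
  by have [->|/Q0/ltW//] := eqVneq v 0; rewrite dot0l.
pose g i := dot (delta_mx i 0) (invmx Q *m delta_mx i 0).
have QVT : (invmx Q)^T = invmx Q by rewrite trmx_inv QT.
have g0 i : 0 <= g i.
  have := Qge (invmx Q *m delta_mx i 0); rewrite mulKVmx//.
  by rewrite dotC.
have key (v : 'cV[R]_n) i : v i 0 ^+ 2 <= dot v (Q *m v) * g i.
  pose w := invmx Q *m delta_mx i 0 : 'cV[R]_n.
  have vw : dot v (Q *m w) = v i 0.
    by rewrite mulKVmx// dotC /dot trmx_delta -rowE mxE.
  have ww : dot w (Q *m w) = g i by rewrite mulKVmx// dotC.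
  have wv : dot w (Q *m v) = v i 0 by rewrite dot_mulmxr QT dotC.
  have H s t : 0 <= s ^+ 2 * dot v (Q *m v) + 2 * s * t * v i 0 + t ^+ 2 * g i.
    have := Qge (s *: v + t *: w); rewrite mulmxDr -!scalemxAr.
    by rewrite !dotDl !dotDr !dotZl !dotZr vw ww wv; lra.
  have [->|/Q0 a0] := eqVneq v 0; first by rewrite dot0l mul0r mxE expr0n.
  (* With [a] the value of the form at [v], the choice [s = v_i], [t = - a] turns [H] into
     [a (a g_i - v_i^2) >= 0], and [a] can be cancelled. *)
  have := H (v i 0) (- dot v (Q *m v)).
  have -> : v i 0 ^+ 2 * dot v (Q *m v) + 2 * v i 0 * - dot v (Q *m v) * v i 0 +
    (- dot v (Q *m v)) ^+ 2 * g i =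
    dot v (Q *m v) * (dot v (Q *m v) * g i - v i 0 ^+ 2) by ring.
  by rewrite pmulr_rge0// subr_ge0.
(* The added 1 makes the denominator positive even in dimension 0. *)
exists (1 + \sum_i g i)^-1; first by rewrite invr_gt0 ltr_pwDl// sumr_ge0.
move=> v; rewrite ler_pdivrMl ?ltr_pwDl ?sumr_ge0//.
rewrite mulrDl mul1r mulr_suml; apply: ler_wpDl => //.
rewrite dotE; apply: ler_sum => i _.
by rewrite -expr2 mulrC; exact: key.
Qed.

(** Each product [|v_i v_j|] is at most [v^T v], so the sum of the absolute entries of [Q] works;
    the added 1 makes the constant positive. *)
Lemma form_bound n (Q : 'M[R]_n) :
  exists2 K, 0 < K & forall v : 'cV[R]_n, dot v (Q *m v) <= K * dot v v.
Proof.
exists (1 + \sum_i \sum_j `|Q i j|) => [|v].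
  by rewrite ltr_pwDl// sumr_ge0// => i _; rewrite sumr_ge0.
rewrite mulrDl mul1r; apply: ler_wpDl; first exact: dot_ge0.
rewrite dotE mulr_suml; apply: ler_sum => i _.
rewrite mxE mulr_sumr mulr_suml; apply: ler_sum => j _.
have vi k : v k 0 ^+ 2 <= dot v v.
  rewrite dotE (bigD1 k)//= -expr2 lerDl sumr_ge0// => l _.
  by rewrite -expr2 sqr_ge0.
apply: le_trans (ler_norm _) _; rewrite mulrCA normrM ler_wpM2l// ler_norml.
by have := vi i; have := vi j; rewrite !expr2; nra.
Qed.

Variables (n m : nat).

(** The velocity [v] is kept independent of [x] and [p]: the term in [Acl x + Bcl p - v] is a
    multiplier that vanishes along the dynamics. The left-hand side is then affine in
    [(Pbar, Acl, Bcl)] for fixed [v], [x], [p], which is what allows averaging over the vertices. *)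
Lemma lmi_form (Jbar Pbar Acl : 'M[R]_n) (Bcl : 'M[R]_(n, m))
    (Gbar C : 'M[R]_(m, n)) (S Wh : 'M[R]_m) (gamma : R) :
    0 < gamma -> Jbar \in unitmx -> S \in unitmx -> S^T = S -> Wh^T = Wh ->
    negdef (star_mx
      (star_mx (- Jbar - Jbar^T) (Pbar + Acl *m Jbar^T - Jbar) (He (Acl *m Jbar^T)))
      (block_mx (Bcl *m S) 0
                (Bcl *m S - Gbar^T - Jbar *m C^T) (Jbar *m C^T *m Wh))
      (star_mx (- (2 *: S)) (S *m Wh) (- gamma%:M))) ->
  let J := invmx Jbar in
  exists2 c, 0 < c & forall (v x : 'cV[R]_n) (p : 'cV[R]_m),
    2 * dot v (J *m Pbar *m J^T *m x)
    + 2 * dot (v + x) (J *m (Acl *m x + Bcl *m p - v))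
    - 2 * dot (invmx S *m p) (p + C *m x + Gbar *m J^T *m x)
    + gamma^-1 * dot (p + C *m x) (Wh *m Wh *m (p + C *m x))
    <= - (c * dot (J^T *m x) (J^T *m x)).
Proof.
move=> g0 Ju Su ST WT Qn J.
have [c c0 cP] := posdef_coercive Qn; exists c => // v x p.
(* In the coordinates [a], [b], [q] the inverses of [Jbar] and [S] disappear from the inequality. *)
pose a := J^T *m v; pose b := J^T *m x; pose q := invmx S *m p.
have vE : v = Jbar^T *m a by rewrite mulmxA -trmx_mul mulVmx// trmx1 mul1mx.
have xE : x = Jbar^T *m b by rewrite mulmxA -trmx_mul mulVmx// trmx1 mul1mx.
have pE : p = S *m q by rewrite mulKVmx.
have JE y u : dot (Jbar^T *m y) (J *m u) = dot y u.
  by rewrite dotC dot_trmx mulKVmx.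
have JK y : J^T *m (Jbar^T *m y) = y.
  by rewrite mulmxA -trmx_mul mulmxV// trmx1 mul1mx.
rewrite vE xE pE mulKmx// -[J *m Pbar *m J^T *m _]mulmxA JK.
rewrite -[J *m Pbar *m b]mulmxA JE -mulmxDr JE -[Gbar *m J^T *m _]mulmxA JK.
move: a b q {vE xE pE} => a b q {v x p}.
set s := S *m q + C *m (Jbar^T *m b).
(* This [w] maximises [2 (Wh s)^T w - gamma w^T w], with value [gamma^-1 |Wh s|^2]; inserting it
   takes the Schur complement of the last block. *)
pose w := gamma^-1 *: (Wh *m s).
have sW u : dot u (Wh *m (Wh *m s)) = dot (Wh *m u) (Wh *m s).
  by rewrite dot_mulmxr WT.
(* Of the squared norm given by coercivity, only the part [b^T b] is kept. *)
have /(le_trans (ler_wpM2l (ltW c0) _)) := cP (col_mx (col_mx a b) (col_mx q w)).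
move=> /(_ (dot b b)); rewrite !dot_colmx => /(_ _)/wrap[].
  by rewrite -addrA ler_wpDl ?dot_ge0// ler_wpDr// addr_ge0 ?dot_ge0.
rewrite mulNmx dotNr !dot_star_mx mul_block_col dot_colmx mul0mx addr0.
rewrite /He !mulmxDl !mulNmx !dotDr !dotNr !dot_trmx !dotDl -!mulmxA.
have e1 u : dot b (Jbar *m (C^T *m u)) = dot u (C *m (Jbar^T *m b)).
  by rewrite dot_mulmxr dot_trmx.
have e2 : dot b (Jbar *m (C^T *m (Wh *m w))) =
    gamma^-1 * dot (Wh *m (C *m (Jbar^T *m b))) (Wh *m s).
  by rewrite e1 dotC dot_mulmxr WT dotZr.
have e3 : dot q (S *m (Wh *m w)) = gamma^-1 * dot (Wh *m (S *m q)) (Wh *m s).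
  by rewrite dot_mulmxr ST dot_mulmxr WT dotZr.
have e4 : dot w (gamma%:M *m w) = gamma^-1 * dot (Wh *m s) (Wh *m s).
  by rewrite mul_scalar_mx dotZr dotZl dotZr mulVKf ?gt_eqF.
have e5 : dot (Wh *m s) (Wh *m s) = dot (Wh *m (S *m q)) (Wh *m s) +
    dot (Wh *m (C *m (Jbar^T *m b))) (Wh *m s).
  by rewrite -dotDl -mulmxDr.
rewrite e2 e1 e3 e4 -[_ *: S *m q]scalemxAl dotZr.
rewrite !sW e5 [Jbar *m (a + b)]mulmxDr dotDr.
by lra.
Qed.

End dot.

(** * Saturation and averaging over the vertices *)

Section saturation.
Variable R : realType.

Lemma satE n (ubar s : 'cV[R]_n) i : 0 < ubar i 0 ->
  sat ubar s i 0 = Num.max (- ubar i 0) (Num.min (s i 0) (ubar i 0)).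
Proof.
move=> u0; rewrite mxE; move: (s i 0) (ubar i 0) u0 => y u u0.
case: (ltgtP y 0) => [y0|y0|->].
- rewrite ltr0_sg// ltr0_norm// mulN1r oppr_min opprK maxC.
  by rewrite [Num.min y u]min_l//; lra.
- rewrite gtr0_sg// gtr0_norm// mul1r max_r// le_min; apply/andP; split; lra.
- by rewrite sgr0 mul0r min_l ?ltW// max_r// oppr_le0 ltW.
Qed.

(** The closed, overlapping regions make [sat] affine in each case, so that later claims reduce to
    polynomial arithmetic. *)
Lemma sat_cases n (ubar s : 'cV[R]_n) i : 0 < ubar i 0 ->
  [\/ s i 0 <= - ubar i 0 /\ sat ubar s i 0 = - ubar i 0,
      - ubar i 0 <= s i 0 <= ubar i 0 /\ sat ubar s i 0 = s i 0 |
      ubar i 0 <= s i 0 /\ sat ubar s i 0 = ubar i 0].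
Proof.
move=> u0; rewrite satE//.
move: (s i 0) (ubar i 0) u0 => y u u0.
have [yu|uy] := leP u y; first by apply: Or33; split=> //; rewrite max_r//; lra.
have [yu'|uy'] := leP y (- u); first by apply: Or31.
by apply: Or32; split=> //; apply/andP; split; apply: ltW.
Qed.

Lemma sat_lipschitz n (ubar s s' : 'cV[R]_n) i : 0 < ubar i 0 ->
  `|sat ubar s i 0 - sat ubar s' i 0| <= `|s i 0 - s' i 0|.
Proof.
move=> u0; have := ler_norm (s i 0 - s' i 0); have := ler_norm (s' i 0 - s i 0).
rewrite (distrC (s' i 0)) ler_norml.
by case: (sat_cases s u0) => -[? ->]; case: (sat_cases s' u0) => -[? ->] *;
  apply/andP; split; lra.
Qed.

(** In the linear region the deadzone is 0. In saturation [sat] is [ubar] or [- ubar], which fixes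
    the sign of [sat + g], and the deadzone has the opposite sign. *)
Lemma sat_sector n (ubar s g : 'cV[R]_n) i : 0 < ubar i 0 ->
  `|g i 0| <= ubar i 0 -> deadzone ubar s i 0 * (sat ubar s + g) i 0 <= 0.
Proof.
move=> u0; rewrite ler_norml => /andP[].
have -> : deadzone ubar s i 0 = sat ubar s i 0 - s i 0 by rewrite !mxE.
have -> : (sat ubar s + g) i 0 = sat ubar s i 0 + g i 0 by rewrite !mxE.
by case: (sat_cases s u0) => -[? ->] *; nra.
Qed.

Lemma sat0 n (ubar : 'cV[R]_n) : sat ubar 0 = 0.
Proof. by apply/matrixP => i j; rewrite !mxE sgr0 mul0r. Qed.

Lemma weighted_sector n (ubar s g : 'cV[R]_n) (S : 'M[R]_n) :
    (forall i, 0 < ubar i 0) -> (forall i, `|g i 0| <= ubar i 0) ->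
    is_diag_mx S -> posdef S ->
  dot (invmx S *m deadzone ubar s) (sat ubar s + g) <= 0.
Proof.
move=> u0 gu /is_diag_mxP Sd Sp; have Su := posdef_unitmx Sp.
case/posdefP: Sp => _ S0.
rewrite dotE; apply: sumr_le0 => i _.
have Sii : 0 < S i i.
  have dn : delta_mx i 0 != 0 :> 'cV[R]_n.
    apply/eqP => /matrixP/(_ i 0); rewrite !mxE !eqxx => /eqP.
    by rewrite oner_eq0.
  by have := S0 _ dn; rewrite /dot trmx_delta -rowE -colE !mxE.
(* Multiplying by [S i i] avoids the entries of the inverse: row [i] of [S (S^-1 p) = p] has a
   single nonzero term because [S] is diagonal. *)
rewrite -(pmulr_rle0 _ Sii) mulrA.
suff -> : S i i * (invmx S *m deadzone ubar s) i 0 = deadzone ubar s i 0.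
  exact: sat_sector.
rewrite -[in RHS](mulKVmx Su (deadzone ubar s)) [RHS]mxE (bigD1 i)//= big1 ?addr0//.
by move=> j ji; rewrite Sd ?mul0r// eq_sym.
Qed.

End saturation.

(** * Averages over the vertices, and decay inside the ellipsoid *)

Section convex_combination.
Variable R : realType.

Lemma posdef_congr n (J P : 'M[R]_n) : J \in unitmx -> posdef P ->
  posdef (J *m P *m J^T).
Proof.
move=> Ju /posdefP[PT P0]; apply/posdefP; split.
  by rewrite !trmx_mul trmxK PT mulmxA.
move=> v v0; rewrite -!mulmxA dot_mulmxr; apply: P0.
apply: contra_neq v0 => JTv.
have JTu : J^T \in unitmx by rewrite unitmx_tr.
by rewrite -[v](mulKmx JTu) JTv mulmx0.
Qed.

Variables (I : finType) (al : I -> R).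
Hypotheses (al0 : forall i, 0 <= al i) (al1 : \sum_i al i = 1).

(** A zero sum would force every weight to vanish, against their total being 1. *)
Lemma convex_sum_gt0 (F : I -> R) : (forall i, 0 < F i) ->
  0 < \sum_i al i * F i.
Proof.
move=> F0; rewrite lt_neqAle sumr_ge0 ?andbT; last first.
  by move=> i _; rewrite mulr_ge0// ltW.
apply/eqP => /esym/psumr_eq0P h.
have a0 i : al i = 0.
  have := h (fun i _ => mulr_ge0 (al0 i) (ltW (F0 i))) i isT.
  by move=> /eqP; rewrite mulf_eq0 (gt_eqF (F0 i)) orbF => /eqP.
by move: al1; rewrite big1// => /eqP; rewrite eq_sym oner_eq0.
Qed.

Lemma dot_convex n m (M : I -> 'M[R]_(m, n)) a b :
  dot a ((\sum_i al i *: M i) *m b) = \sum_i al i * dot a (M i *m b).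
Proof.
rewrite mulmx_suml dot_sumr; apply: eq_bigr => i _.
by rewrite -scalemxAl dotZr.
Qed.

Lemma posdef_convex n (P : I -> 'M[R]_n) : (forall i, posdef (P i)) ->
  posdef (\sum_i al i *: P i).
Proof.
move=> hP; apply/posdefP; split.
  rewrite linear_sum/=; apply: eq_bigr => i _.
  by rewrite linearZ/=; case: (hP i) => ->.
move=> v v0; rewrite dot_convex; apply: convex_sum_gt0 => i.
by have /posdefP[_] := hP i; exact.
Qed.

Lemma convex_cst n m (M : 'M[R]_(m, n)) : \sum_i al i *: M = M.
Proof. by rewrite -scaler_suml al1 scale1r. Qed.

Variables (n m : nat) (ubar : 'cV[R]_m) (Jbar : 'M[R]_n).
Variables (Pbar Acl : I -> 'M[R]_n) (Bcl : I -> 'M[R]_(n, m)).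
Variables (Gbar C : 'M[R]_(m, n)) (S W : 'M[R]_m) (gamma : R).
Hypotheses (u0 : forall j, 0 < ubar j 0) (Ju : Jbar \in unitmx).
Hypothesis g0 : 0 < gamma.
Hypotheses (Sdiag : is_diag_mx S) (hS : posdef S).
Hypotheses (Wdiag : is_diag_mx W) (hW : posdef W).
Hypothesis lmi : forall i, negdef (star_mx
  (star_mx (- Jbar - Jbar^T) (Pbar i + Acl i *m Jbar^T - Jbar)
           (He (Acl i *m Jbar^T)))
  (block_mx (Bcl i *m S) 0 (Bcl i *m S - Gbar^T - Jbar *m C^T)
            (Jbar *m C^T *m sqrt_diag W))
  (star_mx (- (2 *: S)) (S *m sqrt_diag W) (- gamma%:M))).
Hypothesis lmi_sat : forall i j, possemidef
  (star_mx (Pbar i) (row j Gbar)^T (ubar j 0 ^+ 2)%:M).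

Let J := invmx Jbar.
Let P := \sum_i al i *: (J *m Pbar i *m J^T).

Let form_P x : dot x (P *m x) =
  dot (J^T *m x) ((\sum_i al i *: Pbar i) *m (J^T *m x)).
Proof.
rewrite !dot_convex; apply: eq_bigr => i _.
by rewrite -!mulmxA dot_mulmxr.
Qed.

(** Testing the second matrix inequality at [(z, t)] and averaging over the vertices gives
    [1 + 2 t y + ubar_j^2 t^2 >= 0] for every [t], hence [y^2 <= ubar_j^2]. *)
Lemma ellipsoid_gain_le x j : dot x (P *m x) <= 1 ->
  `|(Gbar *m J^T *m x) j 0| <= ubar j 0.
Proof.
move=> x1; have uj := u0 j.
pose z := J^T *m x; pose y := (Gbar *m z) j 0.
rewrite -mulmxA -/z -/y.
have h i (t : R) : 0 <= dot z (Pbar i *m z) + 2 * t * y + ubar j 0 ^+ 2 * t ^+ 2.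
  have [_ /(_ (col_mx z t%:M))] := lmi_sat i j.
  rewrite -mulmxA -/(dot _ _) dot_star_mx.
  have -> : dot z ((row j Gbar)^T *m t%:M) = t * y.
    rewrite dot_trmx -row_mul /dot tr_scalar_mx mul_scalar_mx !mxE.
    by rewrite /y mxE.
  have -> : dot t%:M ((ubar j 0 ^+ 2)%:M *m t%:M) = ubar j 0 ^+ 2 * t ^+ 2.
    rewrite /dot tr_scalar_mx !mul_scalar_mx !mxE eqxx !mulr1n.
    by ring.
  by rewrite mulrA.
have ht (t : R) : 0 <= 1 + 2 * t * y + ubar j 0 ^+ 2 * t ^+ 2.
  have : 0 <= \sum_i al i *
      (dot z (Pbar i *m z) + 2 * t * y + ubar j 0 ^+ 2 * t ^+ 2).
    by apply: sumr_ge0 => i _; rewrite mulr_ge0.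
  have -> : \sum_i al i *
      (dot z (Pbar i *m z) + 2 * t * y + ubar j 0 ^+ 2 * t ^+ 2) =
      dot x (P *m x) + (2 * t * y + ubar j 0 ^+ 2 * t ^+ 2).
    rewrite form_P dot_convex; under eq_bigr do rewrite -addrA mulrDr.
    by rewrite big_split/= -mulr_suml al1 mul1r.
  lra.
have u2 : 0 < ubar j 0 ^+ 2 by rewrite exprn_gt0.
(* This value of [t] minimises the quadratic polynomial. *)
have := ht (- y / ubar j 0 ^+ 2).
have -> : 1 + 2 * (- y / ubar j 0 ^+ 2) * y
    + ubar j 0 ^+ 2 * (- y / ubar j 0 ^+ 2) ^+ 2 =
    (ubar j 0 ^+ 2 - y ^+ 2) / ubar j 0 ^+ 2 by field; rewrite gt_eqF.
rewrite pmulr_lge0 ?invr_gt0// subr_ge0 -(real_normK (num_real y)).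
by rewrite ler_pXn2r ?nnegrE// ltW.
Qed.

Let f x := (\sum_i al i *: Acl i) *m x
  + (\sum_i al i *: Bcl i) *m deadzone ubar (C *m x).

Lemma lmi_decay : exists2 k, 0 < k & forall x, dot x (P *m x) <= 1 ->
  2 * dot (f x) (P *m x)
  + gamma^-1 * dot (sat ubar (C *m x)) (W *m sat ubar (C *m x))
  <= - (k * dot x (P *m x)).
Proof.
have Su := posdef_unitmx hS.
have ST : S^T = S by case: hS.
have sW : sqrt_diag W *m sqrt_diag W = W.
  apply: sqrt_diagK => //; case: hW => WT W0; split=> // v.
  by have [->|/W0/ltW//] := eqVneq v 0; rewrite mulmx0 mxE.
have sWT : (sqrt_diag W)^T = sqrt_diag W.
  have /is_diag_mxP h := sqrt_diag_diag Wdiag.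
  apply/matrixP => i j; rewrite mxE; have [->//|ij] := eqVneq i j.
  by rewrite !h// eq_sym.
have /boolp.choice[c hc] : forall i, exists c, 0 < c /\
    forall (v x : 'cV[R]_n) (p : 'cV[R]_m),
    2 * dot v (J *m Pbar i *m J^T *m x)
    + 2 * dot (v + x) (J *m (Acl i *m x + Bcl i *m p - v))
    - 2 * dot (invmx S *m p) (p + C *m x + Gbar *m J^T *m x)
    + gamma^-1 * dot (p + C *m x) (W *m (p + C *m x))
    <= - (c * dot (J^T *m x) (J^T *m x)).
  move=> i; have [c c0 hc] := lmi_form g0 Ju Su ST sWT (lmi i).
  by exists c; split=> //; move: hc; rewrite sW.
pose c' := \sum_i al i * c i.
have c'0 : 0 < c' by apply: convex_sum_gt0 => i; case: (hc i).
(* [K] converts the margin [c' |J^T x|^2] into a multiple of the Lyapunov function. *)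
have [K K0 hK] := form_bound (\sum_i al i *: Pbar i).
exists (c' / K) => [|x x1]; first by rewrite divr_gt0.
set s := sat ubar (C *m x); set p := deadzone ubar (C *m x).
have ps : p + C *m x = s by rewrite /p /deadzone subrK.
have sec : dot (invmx S *m p) (s + Gbar *m J^T *m x) <= 0.
  by apply: weighted_sector => // j; exact: ellipsoid_gain_le.
(* Every vertex inequality is taken at the same [v = f x], the averaged velocity rather than that of
   the vertex. *)
have : \sum_i al i * (2 * dot (f x) (J *m Pbar i *m J^T *m x)
    + 2 * dot (f x + x) (J *m (Acl i *m x + Bcl i *m p - f x))
    - 2 * dot (invmx S *m p) (s + Gbar *m J^T *m x)
    + gamma^-1 * dot s (W *m s)) <=
    \sum_i al i * - (c i * dot (J^T *m x) (J^T *m x)).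
  apply: ler_sum => i _; apply: ler_wpM2l => //.
  by have [_ /(_ (f x) x p)] := hc i; rewrite ps.
have -> : \sum_i al i * - (c i * dot (J^T *m x) (J^T *m x)) =
    - (c' * dot (J^T *m x) (J^T *m x)).
  by rewrite /c' mulr_suml -sumrN; apply: eq_bigr => i _; ring.
under eq_bigr do rewrite !mulrDr ![al _ * (2 * _)]mulrCA.
rewrite !big_split/= -!mulr_sumr -!mulr_suml al1 !mul1r -dot_convex.
(* The multiplier terms cancel only after averaging, since [f x] is the weighted mean of the vertex
   velocities. *)
have -> : \sum_i al i * dot (f x + x) (J *m (Acl i *m x + Bcl i *m p - f x)) = 0.
  under eq_bigr do rewrite -dotZr scalemxAr.
  rewrite -dot_sumr -mulmx_sumr; under eq_bigr do rewrite scalerBr scalerDr !scalemxAl.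
  rewrite big_split big_split/= -!mulmx_suml sumrN (convex_cst (f x)).
  by rewrite subrr mulmx0 dot0r.
rewrite mulr0 addr0 => h.
have := hK (J^T *m x); rewrite -form_P => hV.
have : c' / K * dot x (P *m x) <= c' * dot (J^T *m x) (J^T *m x).
  by rewrite -mulrA ler_pM2l// ler_pdivrMl.
rewrite -/P in h; move: h sec; lra.
Qed.

End convex_combination.

(** * Global solutions of Lipschitz differential equations *)

Section matrix_entries.
Variable R : realType.

Lemma mxnorm_leP m n (M : 'M[R]_(m, n)) (e : R) : 0 <= e ->
  `|M| <= e <-> forall i j, `|M i j| <= e.
Proof.
move=> e0; rewrite /Num.Def.normr/= mx_normrE; split.
  move=> Me i j; apply: le_trans Me.
  exact: (le_bigmax _ (fun ij : 'I_m * 'I_n => `|M ij.1 ij.2|) (i, j)).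
by move=> Me; apply: bigmax_le => // -[i j] _; exact: Me.
Qed.

Lemma mx_entry_le m n (M : 'M[R]_(m, n)) i j : `|M i j| <= `|M|.
Proof. by move: i j; apply/mxnorm_leP. Qed.

Lemma cvg_mxP (T : Type) (F : set_system T) {FF : Filter F} m n
    (f : T -> 'M[R]_(m, n)) (l : 'M[R]_(m, n)) :
  f @ F --> l <-> forall i j, f x i j @[x --> F] --> l i j.
Proof.
split=> [fl i j|fl].
  apply/cvgrPdist_le => e e0; move/cvgrPdist_le: fl => /(_ e e0).
  apply: filterS => x; apply: le_trans.
  by have := mx_entry_le (l - f x) i j; rewrite !mxE.
apply/cvgrPdist_le => e e0; near=> x.
apply/mxnorm_leP; first exact: ltW.
have : forall ij : 'I_m * 'I_n, `|l ij.1 ij.2 - f x ij.1 ij.2| <= e.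
  near: x; apply: filter_forall => -[i j] /=.
  by have /cvgrPdist_le/(_ e e0) := fl i j.
by move=> h i j; rewrite !mxE; exact: (h (i, j)).
Unshelve. all: by end_near. Qed.

Lemma is_derive_mxP (m n : nat) (M : R -> 'M[R]_(m, n)) (dM : 'M[R]_(m, n)) (t : R) :
  is_derive t 1 M dM <-> forall i j, is_derive t 1 (fun s => M s i j) (dM i j).
Proof.
split=> [[dM1 <-] i j|h].
  by split; [exact: ((derivable_mxP _ _ _).1 dM1)|rewrite derive_mx// mxE].
have dM1 : derivable M t 1 by apply/derivable_mxP => i j; case: (h i j).
split=> //; rewrite derive_mx//; apply/matrixP => i j; rewrite mxE.
by case: (h i j).
Qed.

End matrix_entries.

(** * Picard iteration in an exponentially weighted norm *)

Section ode.
Variable R : realType.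

(* Integrating from -1 keeps 0 inside the interval, where the integral is
   differentiable. *)
Definition primitive (g : R -> R) (t : R) : R :=
  parameterized_integral lebesgue_measure (-1) (Num.max t 0) g -
  parameterized_integral lebesgue_measure (-1) 0 g.

Lemma primitive0 g t : t <= 0 -> primitive g t = 0.
Proof. by move=> t0; rewrite /primitive max_r// subrr. Qed.

Let is_derive_int (g : R -> R) (t : R) : continuous g -> -1 < t ->
  is_derive t 1 (fun x => parameterized_integral lebesgue_measure (-1) x g) (g t).
Proof.
move=> cg t1.
have ig : (@lebesgue_measure R).-integrable `[-1, t + 1] (EFin \o g).
  apply: continuous_compact_integrable; first exact: segment_compact.
  exact: continuous_subspaceT.
have tt : t < t + 1 by rewrite ltrDl.
have [dF] := continuous_FTC1_closed tt ig t1 (cg t).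
by rewrite derive1E => Fg; split.
Qed.

Lemma primitive_continuous (g : R -> R) : continuous g -> continuous (primitive g).
Proof.
move=> cg t; apply: cvgB; last exact: cvg_cst.
have m1 : -1 < Num.max t 0 by rewrite lt_max ltrN10 orbT.
have [/derivable1_diffP/differentiable_continuous cI _] := is_derive_int cg m1.
apply: (@cvg_comp _ _ _ (fun x => Num.max x 0)
  (fun x => parameterized_integral lebesgue_measure (-1) x g) _ _ _ _ cI).
exact: (@continuous_max _ _ id (cst 0) t (@cvg_id _ _) (@cvg_cst _ _ _ _ _)).
Qed.

Lemma is_derive_primitive (g : R -> R) (t : R) : continuous g -> 0 < t ->
  is_derive t 1 (primitive g) (g t).
Proof.
move=> cg t0.
have t1 : -1 < t by apply: lt_trans t0; rewrite ltrN10.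
set c := parameterized_integral lebesgue_measure (-1) 0 g.
have h := is_derive_int cg t1.
have : is_derive t 1
    (fun x => parameterized_integral lebesgue_measure (-1) x g - c) (g t).
  by apply: is_derive_eq; rewrite subr0.
apply: near_eq_is_derive.
by near=> s; rewrite /primitive max_l//; apply: ltW; near: s; exact: lt_nbhsr.
Unshelve. all: by end_near. Qed.

(** The gap [F] between the bound and the difference of primitives is nondecreasing, and
    [F 0 = K / a] is nonnegative. Dividing by [a] is the gain that makes the Picard operator
    contract. *)
Lemma primitive_le_expR (g h : R -> R) (a K t : R) :
    continuous g -> continuous h -> 0 < a -> 0 <= K ->
    (forall s : R, 0 <= s -> `|g s - h s| <= K * expR (a * s)) -> 0 <= t ->
  `|primitive g t - primitive h t| <= K / a * expR (a * t).
Proof.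
move=> cg ch a0 K0 gh t0.
wlog suff H : g h cg ch gh /
    primitive g t - primitive h t <= K / a * expR (a * t).
  rewrite ler_norml; apply/andP; split; last exact: H.
  by rewrite lerNl opprB; apply: H => // s s0; rewrite distrC; exact: gh.
pose F s := K / a * expR (a * s) - (primitive g s - primitive h s).
have dF (s : R) : 0 < s -> is_derive s 1 F (K * expR (a * s) - (g s - h s)).
  move=> s0; have dg := is_derive_primitive cg s0.
  have dh := is_derive_primitive ch s0.
  apply: is_derive_eq; congr (_ - _).
  rewrite [LHS](_ : _ = K / a * (expR (a * s) * (a * 1)))//.
  by field; rewrite gt_eqF.
have cF : continuous F.
  move=> s; apply: cvgB; last by apply: cvgB; exact: primitive_continuous.
  apply: cvgM; first exact: cvg_cst.
  apply: (@cvg_comp _ _ _ (fun x => a * x) expR); last exact: continuous_expR.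
  by apply: cvgM; [exact: cvg_cst|exact: cvg_id].
have : F 0 <= F t.
  apply: (@ger0_derive1_ndecry _ F 0 _ _ _ 0 t (lexx 0) t0).
  - by move=> s; rewrite in_itv/= andbT => s0; have [] := dF s s0.
  - move=> s; rewrite in_itv/= andbT => s0; have [_] := dF s s0.
    rewrite derive1E => ->; rewrite subr_ge0 (le_trans (ler_norm _))//.
    by rewrite gh// ltW.
  - exact: continuous_subspaceT.
rewrite /F !(@primitive0 _ 0)// subrr subr0 mulr0 expR0 mulr1 => F0.
by rewrite -subr_ge0 (le_trans _ F0)// divr_ge0// ltW.
Qed.

(** The lower bounds [u k - 2 M / 2^k] increase and stay below every [u j + 2 M / 2^j]; their
    supremum is the limit. *)
Lemma geometric_cvg (u : R ^nat) (M : R) :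
    (forall k, `|u k.+1 - u k| <= M / 2 ^+ k) ->
  exists l, forall k, `|l - u k| <= 2 * M / 2 ^+ k.
Proof.
move=> hu.
have M0 : 0 <= M by have := le_trans (normr_ge0 _) (hu 0); rewrite expr0 divr1.
(* Keeping the subtracted tail makes the bound telescope, so the induction closes. *)
have hd k j : `|u (k + j)%N - u k| <= 2 * M / 2 ^+ k - 2 * M / 2 ^+ (k + j).
  elim: j => [|j IH]; first by rewrite addn0 !subrr normr0.
  rewrite addnS -(subrKA (u (k + j)%N)) (le_trans (ler_normD _ _))//.
  apply: le_trans (lerD (hu _) IH) _; rewrite exprS.
  have p0 : (2 ^+ (k + j) : R) != 0 by rewrite expf_neq0.
  rewrite le_eqVlt; apply/orP; left; apply/eqP.
  by field; rewrite p0 expf_neq0.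
have v0 k : 0 <= 2 * M / 2 ^+ k by rewrite divr_ge0 ?mulr_ge0 ?exprn_ge0.
pose v k := u k - 2 * M / 2 ^+ k.
have vE k j : v k <= v (k + j)%N /\ v (k + j)%N <= u k + 2 * M / 2 ^+ k.
  have := hd k j; rewrite ler_norml /v => /andP[].
  by have := v0 (k + j)%N; have := v0 k; split; lra.
have vub j k : v j <= u k + 2 * M / 2 ^+ k.
  have [jk|/ltnW kj] := leqP j k; last by rewrite -(subnKC kj); case: (vE k (j - k)%N).
  rewrite (le_trans (vE j (k - j)%N).1)// subnKC// /v.
  by have := v0 k; lra.
have hs : has_sup (range v).
  split; first by exists (v 0%N), 0%N.
  by exists (u 0%N + 2 * M / 2 ^+ 0) => _ [j _ <-]; exact: vub.
exists (sup (range v)) => k; rewrite ler_norml; apply/andP; split.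
  rewrite lerBrDl; apply: (ub_le_sup hs.2); by exists k.
rewrite lerBlDl; apply: ge_sup; first exact: hs.1.
by move=> _ [j _ <-]; exact: vub.
Qed.

Lemma lipschitz_continuous (n : nat) (f : 'cV[R]_n -> 'cV[R]_n) (k : R) :
    0 < k -> (forall x y, `|f x - f y| <= k * `|x - y|) -> continuous f.
Proof.
move=> k0 fk x;apply/(@cvgrPdist_le _ _ _ (nbhs x) _ f (f x)) => e e0.
have d0 : 0 < k^-1 * e by rewrite mulr_gt0// invr_gt0.
apply: filterS (nbhsx_ballx x _ d0) => y; rewrite -ball_normE /= => /ltW xy.
by apply: le_trans (fk _ _) _; rewrite -ler_pdivlMl.
Qed.

Variables (n : nat) (f : 'cV[R]_n -> 'cV[R]_n) (x0 : 'cV[R]_n).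

(** The value is constantly [x0] for [t <= 0], so that iterates are continuous on the whole line. *)
Definition picard (y : R -> 'cV[R]_n) (t : R) : 'cV[R]_n :=
  x0 + \col_i primitive (fun s => f (y s) i 0) t.

Lemma picard_le0 y t : t <= 0 -> picard y t = x0.
Proof.
move=> t0; apply/matrixP => i j; rewrite !mxE.
by rewrite primitive0// addr0.
Qed.

Let entry_continuous (y : R -> 'cV[R]_n) i : continuous y ->
  continuous (fun s => y s i 0 : R).
Proof. by move=> cy s; move: s i 0 => s; apply/cvg_mxP; exact: cy. Qed.

Lemma picard_continuous y : continuous f -> continuous y ->
  continuous (picard y).
Proof.
move=> cf cy t; apply/cvg_mxP => i j; rewrite mxE.
under eq_fun do rewrite !mxE.
apply: cvgD; first exact: cvg_cst.
rewrite mxE; apply: primitive_continuous.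
apply: (entry_continuous (y := f \o y)) => s.
by apply: continuous_comp; [exact: cy|exact: cf].
Qed.

Lemma is_derive_picard y (t : R) : continuous f -> continuous y -> 0 < t ->
  is_derive t 1 (picard y) (f (y t)).
Proof.
move=> cf cy t0; apply/is_derive_mxP => i j; rewrite (ord1 j).
have -> : (fun s => picard y s i 0) =
    cst (x0 i 0) + primitive (fun s => f (y s) i 0).
  by apply/funext => s; rewrite !mxE.
have c : continuous (fun s => f (y s) i 0).
  apply: (entry_continuous (y := f \o y)) => s.
  by apply: continuous_comp; [exact: cy|exact: cf].
have := is_derive_primitive c t0 => ?.
by apply: is_derive_eq; rewrite add0r.
Qed.

Variable k : R.
Hypotheses (k0 : 0 < k) (fk : forall x y, `|f x - f y| <= k * `|x - y|).

Let fc : continuous f.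
Proof. exact: lipschitz_continuous k0 fk. Qed.

(* The weight exp(2 k t) makes the Picard operator a contraction of ratio 1/2. *)
Lemma picard_contraction y z (K : R) : continuous y -> continuous z -> 0 <= K ->
  (forall t : R, 0 <= t -> `|y t - z t| <= K * expR (2 * k * t)) ->
  forall t : R, 0 <= t -> `|picard y t - picard z t| <= K / 2 * expR (2 * k * t).
Proof.
move=> cy cz K0 yz t t0.
apply/mxnorm_leP => [|i j]; first by rewrite !mulr_ge0// expR_ge0.
rewrite !mxE opprD addrACA subrr add0r.
have -> : K / 2 = k * K / (2 * k) by field; rewrite gt_eqF.
have c (w : R -> 'cV[R]_n) : continuous w -> continuous (fun s => f (w s) i 0).
  move=> cw; apply: (entry_continuous (y := f \o w)) => s.
  by apply: continuous_comp; [exact: cw|exact: fc].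
apply: primitive_le_expR => //; [exact: c|exact: c|by rewrite mulr_gt0| |].
  by rewrite mulr_ge0// ltW.
move=> s s0; have := mx_entry_le (f (y s) - f (z s)) i 0.
rewrite !mxE => /le_trans; apply; apply: le_trans (fk _ _) _.
by rewrite -mulrA ler_pM2l//; exact: yz.
Qed.

Let y_ (j : nat) := iter j picard (cst x0).

Let y_continuous j : continuous (y_ j).
Proof.
elim: j => [|j IH]; first exact: cst_continuous.
exact: picard_continuous.
Qed.

Let y_le0 j (t : R) : t <= 0 -> y_ j t = x0.
Proof. by case: j => // j; exact: picard_le0. Qed.

(** Size of the first increment in the weighted norm: [primitive_le_expR] with [K = |f x0|] and rate
    [2 k]. *)
Let M := `|f x0| / (2 * k).

(** The weight, extended by 1 to negative times, where all iterates agree. *)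
Let w (t : R) := expR (2 * k * Num.max t 0).

Let wE (t : R) : 0 <= t -> w t = expR (2 * k * t).
Proof. by move=> t0; rewrite /w max_l. Qed.

Let w0 t : 0 <= w t. Proof. exact: expR_ge0. Qed.

Let k20 : 0 < 2 * k. Proof. by rewrite mulr_gt0. Qed.

Let M0 : 0 <= M. Proof. by rewrite divr_ge0// ltW. Qed.

Let y_step j (t : R) : `|y_ j.+1 t - y_ j t| <= M / 2 ^+ j * w t.
Proof.
have [t0|/ltW t0] := leP t 0.
  by rewrite !y_le0// subrr normr0 mulr_ge0// divr_ge0// exprn_ge0.
rewrite wE//; elim: j t t0 => [|j IH] t t0; last first.
  rewrite exprSr invfM mulrA.
  have K0 : 0 <= M / 2 ^+ j by rewrite divr_ge0// exprn_ge0.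
  exact: (picard_contraction (@y_continuous j.+1) (@y_continuous j) K0 IH).
rewrite expr0 divr1.
apply/mxnorm_leP => [|i l]; first by rewrite mulr_ge0 ?expR_ge0.
rewrite !mxE/= addrAC subrr add0r.
have h : primitive (cst 0) t = 0 :> R.
  by rewrite /primitive /parameterized_integral !Rintegral_cst//= !mul0r subrr.
rewrite -[X in `|X|]subr0 -h; apply: primitive_le_expR => //.
- exact: cst_continuous.
- exact: cst_continuous.
- move=> s s0; rewrite /= subr0.
  have := mx_entry_le (f x0) i 0 => /le_trans; apply.
  have ks : 0 <= 2 * k * s by rewrite mulr_ge0// ltW.
  by rewrite ler_peMr// (le_trans _ (expR_ge1Dx _))// lerDl.
Qed.

Let half_pow_lt (C e : R) : 0 < e -> exists j, C / 2 ^+ j < e.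
Proof.
move=> e0; have h : `|2^-1 : R| < 1 by rewrite ger0_norm// invf_lt1// ltr1n.
have /(@cvgr_lt _ _ _ _ _ 0)/(_ e e0) := cvg_geometric C h.
by move=> /filter_ex[j]; rewrite /= exprVn; exists j.
Qed.

Let half_pow_le (C r : R) : (forall j, r <= C / 2 ^+ j) -> r <= 0.
Proof.
move=> h; rewrite leNgt; apply/negP => /half_pow_lt-/(_ C)[j].
by rewrite ltNge h.
Qed.

(** The iterates converge with error [2 M w(t) / 2^j], locally uniformly in [t]; the limit is
    therefore continuous, and it is a fixed point of [picard] for [t >= 0]. *)
Lemma lipschitz_solution : exists x, solution f x0 x.
Proof.
have M20 : 0 <= 2 * M by exact: mulr_ge0.
have C0 t : 0 <= 2 * M * w t by exact: mulr_ge0.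
have /boolp.choice[l hl] : forall ti : R * 'I_n, exists a, forall j,
    `|a - y_ j ti.1 ti.2 0| <= 2 * M * w ti.1 / 2 ^+ j.
  move=> [t i] /=; rewrite -mulrA; apply: geometric_cvg => j.
  have := mx_entry_le (y_ j.+1 t - y_ j t) i 0.
  by rewrite !mxE mulrAC => /le_trans; apply; exact: y_step.
pose x t := \col_i l (t, i) : 'cV[R]_n.
have xy t j : `|x t - y_ j t| <= 2 * M * w t / 2 ^+ j.
  apply/mxnorm_leP => [|i a]; first by rewrite divr_ge0 ?exprn_ge0.
  by rewrite (ord1 a) !mxE; exact: (hl (t, i)).
have cx : continuous x.
  move=> t; apply/(@cvgrPdist_le _ _ _ (nbhs t) _ x (x t)) => e e0.
  have e30 : 0 < e / 3 by rewrite divr_gt0.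
  (* One rank [j] serves all times up to [|t| + 1], which contains a neighbourhood of [t]. *)
  have [j jC] := half_pow_lt (2 * M * expR (2 * k * (`|t| + 1))) e30.
  have wj s : s <= `|t| + 1 -> 2 * M * w s / 2 ^+ j <= e / 3.
    move=> st; apply: le_trans (ltW jC).
    rewrite ler_pM2r ?invr_gt0 ?exprn_gt0// ler_wpM2l//.
    by rewrite ler_expR ler_pM2l// ge_max st addr_ge0.
  have := @y_continuous j t => /(@cvgrPdist_le _ _ _ (nbhs t) _)/(_ _ e30) cy.
  near=> s.
  rewrite -(subrKA (y_ j t)) (le_trans (ler_normD _ _))//.
  have -> : e = e / 3 + (e / 3 + e / 3) by field.
  apply: lerD.
    by apply: le_trans (xy _ _) _; apply: wj; rewrite ler_wpDr// ler_norm.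
  rewrite -(subrKA (y_ j s)) (le_trans (ler_normD _ _))// lerD//.
    by near: s.
  rewrite distrC (le_trans (xy _ _))// wj//.
  rewrite -lerBlDl; apply: (@le_trans _ _ `|t - s|).
    rewrite distrC (le_trans _ (ler_dist_dist _ _))//.
    by rewrite (le_trans _ (ler_norm _))// lerB// ler_norm.
  near: s; exact: (@cvgr_dist_le _ _ _ (nbhs t) _ id t (@cvg_id _ _) 1 ltr01).
have xP t : 0 <= t -> picard x t = x t.
  move=> t0; apply/eqP; rewrite -subr_eq0 -normr_le0.
  apply: (@half_pow_le (2 * M * w t)) => j.
  have K0 : 0 <= 2 * M / 2 ^+ j by rewrite divr_ge0 ?exprn_ge0.
  rewrite -(subrKA (y_ j.+1 t)) (le_trans (ler_normD _ _))//.
  (* Half of the error is the contracted distance from [x] to iterate [j], the other half the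
     distance from [x] to iterate [j + 1]. *)
  have -> : 2 * M * w t / 2 ^+ j =
      2 * M / 2 ^+ j / 2 * expR (2 * k * t) + 2 * M * w t / 2 ^+ j.+1.
    by rewrite wE// exprS; field; rewrite expf_neq0.
  apply: lerD; last by rewrite distrC.
  apply: (picard_contraction cx (@y_continuous j) K0) => // s s0.
  by rewrite -wE// mulrAC.
exists x; split; first by rewrite -xP// picard_le0.
split; first exact: continuous_subspaceT.
move=> t; rewrite interior_itv_bndy /= in_itv /= andbT => t0.
apply: near_eq_is_derive (is_derive_picard fc cx t0).
by near=> s; apply: xP; apply: ltW; near: s; exact: lt_nbhsr.
Unshelve. all: by end_near. Qed.

End ode.

(** * Lyapunov analysis *)

Section calculus.
Variable R : realType.

Lemma cvg_dot (T : Type) (F : set_system T) {FF : Filter F} n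
    (a b : T -> 'cV[R]_n) (la lb : 'cV[R]_n) :
  a @ F --> la -> b @ F --> lb -> dot (a t) (b t) @[t --> F] --> dot la lb.
Proof.
move=> /cvg_mxP ca /cvg_mxP cb; under eq_fun do rewrite dotE.
rewrite dotE; apply: cvg_big => [|i _]; [exact: add_continuous|exact: cvgM].
Qed.

Lemma cvg_mulmx (T : Type) (F : set_system T) {FF : Filter F} m n
    (A : 'M[R]_(m, n)) (a : T -> 'cV[R]_n) (la : 'cV[R]_n) :
  a @ F --> la -> A *m a t @[t --> F] --> A *m la.
Proof.
move=> ca; apply/cvg_mxP => i j.
have E x : (A *m x) i j = dot (row i A)^T x.
  by rewrite (ord1 j) /dot trmxK -row_mul [RHS]mxE.
by rewrite E; under eq_fun do rewrite E; apply: cvg_dot => //; exact: cvg_cst.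
Qed.

Lemma is_derive_dot n (a b : R -> 'cV[R]_n) (da db : 'cV[R]_n) (t : R) :
  is_derive t 1 a da -> is_derive t 1 b db ->
  is_derive t 1 (fun s => dot (a s) (b s)) (dot da (b t) + dot (a t) db).
Proof.
move=> /is_derive_mxP ha /is_derive_mxP hb.
have -> : (fun s => dot (a s) (b s)) =
    \sum_i ((fun s => a s i 0) * (fun s => b s i 0)).
  by apply/funext => s; rewrite dotE fct_sumE.
rewrite !dotE -big_split/=; apply: is_derive_sum => i.
have := ha i 0; have := hb i 0 => ? ?; apply: is_derive_eq.
by rewrite /GRing.scale/= addrC [da i 0 * _]mulrC.
Qed.

Lemma is_derive_mulmx m n (A : 'M[R]_(m, n)) (a : R -> 'cV[R]_n) da (t : R) :
  is_derive t 1 a da -> is_derive t 1 (fun s => A *m a s) (A *m da).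
Proof.
move=> ha; apply/is_derive_mxP => i j.
have E x : (A *m x) i j = dot (row i A)^T x.
  by rewrite (ord1 j) /dot trmxK -row_mul [RHS]mxE.
rewrite E; under eq_fun do rewrite E.
have := is_derive_dot (is_derive_cst (row i A)^T t 1) ha.
by rewrite dot0l add0r.
Qed.

Lemma is_derive_form n (P : 'M[R]_n) (a : R -> 'cV[R]_n) da (t : R) : P^T = P ->
  is_derive t 1 a da ->
  is_derive t 1 (fun s => dot (a s) (P *m a s)) (2 * dot da (P *m a t)).
Proof.
move=> PT ha; have := is_derive_dot ha (is_derive_mulmx P ha).
by rewrite [dot (a t) _]dot_mulmxr PT [dot (P *m _) _]dotC -mulr2n mulr_natl.
Qed.

(** Passes from quadratic forms to the maximum norm used in stability and convergence. *)
Lemma normrX2_le_dot n (a : 'cV[R]_n) : `|a| ^+ 2 <= dot a a.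
Proof.
rewrite -(@sqr_sqrtr _ (dot a a)) ?dot_ge0//.
rewrite ler_pXn2r ?nnegrE ?sqrtr_ge0//.
apply/mxnorm_leP => [|i j]; first exact: sqrtr_ge0.
rewrite -sqrtr_sqr ler_wsqrtr// (ord1 j) dotE (bigD1 i)//= -expr2 lerDl.
by rewrite sumr_ge0// => k _; rewrite -expr2 sqr_ge0.
Qed.

(** Freezing a trajectory at its initial value for negative times replaces continuity within the
    half-line by plain continuity. *)
Lemma continuous_right_extension n (x : R -> 'cV[R]_n) :
  {within `[0, +oo[, continuous x} -> continuous (fun t : R => x (Num.max t 0)).
Proof.
move=> /continuous_within_itvcyP[cx cx0] t.
have [t0|t0|->] := ltgtP t 0.
- apply: (@cvg_trans _ (cst (x (Num.max t 0)) @ nbhs t)); last exact: cvg_cst.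
  apply: near_eq_cvg.
  near=> s; rewrite /= max_r; last exact: ltW.
  by rewrite max_r//; apply: ltW; near: s; exact: lt_nbhsl.
- rewrite /continuous_at; have -> : x (Num.max t 0) = x t by rewrite max_l// ltW.
  have /cx : t \in `]0, +oo[ by rewrite in_itv/= t0.
  apply: cvg_trans.
  apply: near_eq_cvg; near=> s; rewrite max_l//.
  by apply: ltW; near: s; exact: lt_nbhsr.
- rewrite /continuous_at maxxx; apply/(@cvgrPdist_le _ _ _ (nbhs 0) _ _ (x 0)) => e e0.
  move/(@cvgrPdist_le _ _ _ (at_right 0) _ x (x 0))/(_ e e0) : cx0.
  move=> [d /= d0 hd]; exists d => //= s sd.
  have [s0|s0] := ltP 0 s; last by rewrite subrr normr0 ltW.
  exact: hd.
Unshelve. all: by end_near. Qed.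

End calculus.

(** * Scalar differential inequalities *)

Section barrier.
Variable R : realType.

(* If v could only leave ]-oo, c] through c, its derivative there would have to
   be nonnegative. *)
Lemma sublevel_invariant (v h : R -> R) (c : R) :
    continuous v -> continuous h ->
    (forall t : R, 0 < t -> is_derive t 1 v (h t)) ->
    (forall t : R, 0 <= t -> v t = c -> h t < 0) ->
  v 0 <= c -> forall t : R, 0 <= t -> v t <= c.
Proof.
move=> cv ch dv hneg v0 t1 t10; rewrite leNgt; apply/negP => vt1.
(* The bound persists for a short time: by continuity of [v] when it is strict, and when [v t = c]
   because [h] stays negative near [t], so that [v] does not increase. *)
have step (t : R) : 0 <= t -> v t <= c ->
    exists2 d, 0 < d & forall s : R, t <= s <= t + d -> v s <= c.
  move=> t0; rewrite le_eqVlt => /orP[/eqP vtc|vtc]; last first.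
    have /(@cvgr_lt _ _ _ _ _ (v t))/(_ c vtc)[d /= d0 hd] := cv t.
    exists (d / 2) => [|s /andP[ts std]]; first by rewrite divr_gt0.
    apply/ltW/hd => /=; rewrite ler0_norm; lra.
  have /(@cvgr_lt _ _ _ _ _ (h t))/(_ 0 (hneg t t0 vtc))[d /= d0 hd] := ch t.
  exists (d / 2) => [|s /andP[ts std]]; first by rewrite divr_gt0.
  rewrite -vtc; apply: (ler0_derive1_nincr (a := t) (b := t + d / 2)) => //.
  - move=> y; rewrite in_itv/= => /andP[ty _].
    by have [] := dv y (le_lt_trans t0 ty).
  - move=> y; rewrite in_itv/= => /andP[ty yd].
    rewrite derive1E; have [_ ->] := dv y (le_lt_trans t0 ty).
    apply/ltW/hd => /=; rewrite ltr0_norm; lra.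
  - exact: continuous_subspaceT.
(* [S] need not be an interval: its supremum is the last time before [t1] at which the bound holds,
   and [step] moves beyond it. *)
pose S := [set t : R | 0 <= t <= t1 /\ v t <= c].
have S0 : S 0 by split=> //; rewrite lexx.
have Sub : has_ubound S by exists t1 => t [/andP[]].
have hS : has_sup S by split=> //; exists 0.
pose t0 := sup S.
have t00 : 0 <= t0 by exact: ub_le_sup.
have t0t1 : t0 <= t1 by apply: ge_sup; [exists 0|move=> t [/andP[]]].
have vt0 : v t0 <= c.
  rewrite leNgt; apply/negP => vt0.
  have /(@cvgr_gt _ _ _ _ _ (v t0))/(_ c vt0)[d /= d0 hd] := cv t0.
  have [s Ss ds] := sup_adherent d0 hS.
  have st0 : s <= t0 by exact: ub_le_sup.
  suff : c < v s by rewrite ltNge Ss.2.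
  rewrite -/t0 in ds; apply: hd => /=.
  by rewrite ger0_norm ?subr_ge0//; lra.
have [d d0 hd] := step t0 t00 vt0.
have t0t1' : t0 < t1.
  rewrite lt_neqAle t0t1 andbT; apply/eqP => E.
  by move: vt1; rewrite -E ltNge vt0.
pose s := Num.min (t0 + d) t1.
have t0s : t0 < s by rewrite lt_min t0t1' ltrDl d0.
have : s <= t0.
  apply: ub_le_sup => //; split.
    by rewrite ge_min lexx orbT andbT (le_trans t00)// ltW.
  by apply: hd; rewrite ge_min lexx andbT ltW.
by rewrite leNgt t0s.
Qed.

(** Gronwall's argument: [expR (k s) * v s] has nonpositive derivative. *)
Lemma exp_decay (v h : R -> R) (k : R) : continuous v ->
    (forall t : R, 0 < t -> is_derive t 1 v (h t)) ->
    (forall t : R, 0 < t -> h t <= - (k * v t)) ->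
  forall t : R, 0 <= t -> v t <= expR (- (k * t)) * v 0.
Proof.
move=> cv dv hv t t0.
pose F (s : R) := expR (k * s) * v s.
have dF (s : R) : 0 < s -> is_derive s 1 F (expR (k * s) * (k * v s + h s)).
  move=> s0; have := dv s s0 => ?; apply: is_derive_eq.
  rewrite [LHS](_ : _ = expR (k * s) * h s + v s * (expR (k * s) * (k * 1)))//.
  by ring.
have : F t <= F 0.
  apply: (@ler0_derive1_nincry _ F 0 _ _ _ 0 t (lexx 0) t0).
  - by move=> s; rewrite in_itv/= andbT => s0; have [] := dF s s0.
  - move=> s; rewrite in_itv/= andbT => s0; have [_] := dF s s0.
    rewrite derive1E => ->; rewrite pmulr_rle0 ?expR_gt0//.
    by have := hv s s0; lra.
  - apply: continuous_subspaceT => s; apply: cvgM; last exact: cv.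
    apply: (@cvg_comp _ _ _ (fun x => k * x) expR); last exact: continuous_expR.
    by apply: cvgM; [exact: cvg_cst|exact: cvg_id].
rewrite /F mulr0 expR0 mul1r => Ft.
by rewrite expRN ler_pdivlMl ?expR_gt0.
Qed.

End barrier.

(** * Stability, basin of attraction and cost from a quadratic Lyapunov function *)

Section lyapunov.
Variables (R : realType) (n : nat).
Variables (f : 'cV[R]_n -> 'cV[R]_n) (P : 'M[R]_n) (g : 'cV[R]_n -> R).
Variables (L k gamma : R).
Hypotheses (L0 : 0 < L) (k0 : 0 < k) (gamma0 : 0 < gamma).
Hypothesis f_lip : forall x y, `|f x - f y| <= L * `|x - y|.
Hypotheses (f0 : f 0 = 0) (hP : posdef P) (cg : continuous g) (g0 : forall x, 0 <= g x).
Hypothesis decay : forall x, dot x (P *m x) <= 1 ->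
  2 * dot (f x) (P *m x) + gamma^-1 * g x <= - (k * dot x (P *m x)).

Let V x := dot x (P *m x).

Let cf : continuous f.
Proof. exact: lipschitz_continuous L0 f_lip. Qed.

Let cV : continuous V.
Proof.
move=> x; apply: (@cvg_dot _ _ (nbhs x) _ _ id (mulmx P) x (P *m x) cvg_id).
exact: (@cvg_mulmx _ _ (nbhs x) _ _ _ P id x cvg_id).
Qed.

Let V_gt0 x : x != 0 -> 0 < V x.
Proof. by case/posdefP: hP => _; exact. Qed.

Let V_ge0 x : 0 <= V x.
Proof. by have [->|/V_gt0/ltW//] := eqVneq x 0; rewrite /V dot0l. Qed.

(** The derivative of [V] along the flow of [f]. *)
Let h x := 2 * dot (f x) (P *m x).

Let ch : continuous h.
Proof.
move=> x; apply: (@cvgM _ _ (nbhs x) _ (cst 2)); first exact: cvg_cst.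
apply: (@cvg_dot _ _ (nbhs x) _ _ f (mulmx P) (f x) (P *m x)).
  exact: cf.
by exact: (@cvg_mulmx _ _ (nbhs x) _ _ _ P id x cvg_id).
Qed.

Section trajectory.
Variables (x0 : 'cV[R]_n) (x : R -> 'cV[R]_n).
Hypotheses (xsol : solution f x0 x) (Vx0 : V x0 <= 1).

Let X (t : R) := x (Num.max t 0).

Let XE (t : R) : 0 <= t -> X t = x t.
Proof. by move=> t0; rewrite /X max_l. Qed.

Let X0 : X 0 = x0.
Proof. by rewrite XE//; case: xsol. Qed.

Let cX : continuous X.
Proof. by apply: continuous_right_extension; case: xsol => _ []. Qed.

Let dX (t : R) : 0 < t -> is_derive t 1 X (f (X t)).
Proof.
move=> t0; rewrite XE ?ltW//; case: xsol => _ [_ /(_ t)].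
rewrite interior_itv_bndy/= in_itv/= andbT => /(_ t0); apply: near_eq_is_derive.
by near=> s; rewrite XE// ltW//; near: s; exact: lt_nbhsr.
Unshelve. all: by end_near. Qed.

Let v t := V (X t).

Let cv : continuous v.
Proof. by move=> t; apply: (@cvg_comp _ _ _ X V _ _ _ (@cX t)); exact: cV. Qed.

Let chX : continuous (fun t => h (X t)).
Proof. by move=> t; apply: (@cvg_comp _ _ _ X h _ _ _ (@cX t)); exact: ch. Qed.

Let dv (t : R) : 0 < t -> is_derive t 1 v (h (X t)).
Proof. by move=> t0; apply: is_derive_form; [case: hP|exact: dX]. Qed.

Let h_le y : V y <= 1 -> h y <= - (k * V y).
Proof.
move=> /decay; apply: le_trans; rewrite lerDl mulr_ge0// invr_ge0 ltW//.
Qed.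

(** The decay inequality is available only inside the ellipsoid, so invariance comes first; on the
    boundary it gives [h <= - k < 0]. *)
Let v_le1 (t : R) : 0 <= t -> v t <= 1.
Proof.
apply: (sublevel_invariant cv chX) => //; last by rewrite /v X0.
move=> s s0 vs; apply: le_lt_trans (h_le _) _; first by rewrite -/(v s) vs.
by rewrite -/(v s) vs mulr1 oppr_lt0.
Qed.

Let v_exp (t : R) : 0 <= t -> v t <= expR (- (k * t)) * V x0.
Proof.
rewrite -X0; apply: (exp_decay cv dv) => s s0.
by apply: h_le; apply: v_le1; exact: ltW.
Qed.

Lemma trajectory_form_le (t : R) : 0 <= t -> V (x t) <= V x0.
Proof.
move=> t0; rewrite -XE//; apply: le_trans (v_exp t0) _.
rewrite ler_piMl// -expR0 ler_expR oppr_le0 mulr_ge0// ltW//.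
Qed.

Let v_cvg0 : v t @[t --> +oo] --> 0.
Proof.
apply: (@squeeze_cvgr _ _ _ _ (cst 0) (fun t => expR (- (k * t)) * V x0)).
- near=> t; rewrite V_ge0/=; apply: v_exp; near: t; exact: nbhs_pinfty_ge.
- exact: cvg_cst.
- rewrite -(mul0r (V x0)); apply: cvgM; last exact: cvg_cst.
  apply: (@cvg_comp _ _ _ (fun t => k * t) (fun t => expR (- t))).
    by apply: gt0_cvgMry => //; exact: cvg_id.
  exact: cvgr_expR.
Unshelve. all: by end_near. Qed.

Lemma trajectory_cvg0 : x t @[t --> +oo] --> (0 : 'cV[R]_n).
Proof.
have [c c0 hc] := posdef_coercive hP.
apply/cvgrPdist_le => e e0.
have ce0 : 0 < c * e ^+ 2 by rewrite mulr_gt0// exprn_gt0.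
near=> t.
have t0 : 0 <= t by near: t; exact: nbhs_pinfty_ge.
rewrite sub0r normrN -(@ler_pXn2r _ 2%N) ?nnegrE// ?(ltW e0)//.
apply: le_trans (normrX2_le_dot _) _; rewrite -(ler_pM2l c0).
apply: le_trans (hc _) _; rewrite -XE//; apply: ltW; rewrite -/(v t).
near: t; exact: (cvgr_lt _ v_cvg0).
Unshelve. all: by end_near. Qed.

(** The integrand is at most [- gamma] times the derivative of [v], and [v] tends to 0, so the
    integral is at most [gamma * V x0], hence at most [gamma]. *)
Lemma trajectory_cost :
  (\int[lebesgue_measure]_(t in `[0%R, +oo[) (g (x t))%:E <= gamma%:E)%E.
Proof.
have hX (t : R) : 0 <= t -> g (X t) <= - gamma * h (X t).
  move=> t0; have := decay (v_le1 t0); rewrite -/(h _) -/(V _) -/(v t).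
  have kv : 0 <= k * v t by rewrite mulr_ge0 ?V_ge0// ltW.
  move=> H; rewrite mulNr -mulrN -ler_pdivrMl//; lra.
apply: (@le_trans _ _ (\int[lebesgue_measure]_(t in `[0%R, +oo[)
    (- gamma * h (X t))%:E)%E).
  have -> : (\int[lebesgue_measure]_(t in `[0%R, +oo[) (g (x t))%:E =
      \int[lebesgue_measure]_(t in `[0%R, +oo[) (g (X t))%:E)%E.
    apply: eq_integral => t; rewrite inE/= in_itv/= andbT => t0.
    by rewrite XE.
  apply: ge0_le_integral => //=.
  - by move=> t _; rewrite lee_fin.
  - apply/measurable_EFinP; apply: measurable_funTS.
    apply: continuous_measurable_fun => t.
    by apply: (@cvg_comp _ _ _ X g _ _ _ (@cX t)); exact: cg.
  - apply/measurable_EFinP; apply: measurable_funTS.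
    apply: continuous_measurable_fun => t.
    by apply: cvgM; [exact: cvg_cst|exact: chX].
  - by move=> t; rewrite in_itv/= andbT => t0; rewrite lee_fin hX.
rewrite (@ge0_continuous_FTC2y _ _ (fun t => - gamma * v t) _ 0).
- by rewrite add0e -EFinN lee_fin mulNr opprK /v X0 ger_pMr.
- by move=> t t0; apply: le_trans (hX t t0).
- apply: continuous_subspaceT => t; apply: cvgM; [exact: cvg_cst|exact: chX].
- rewrite -(mulr0 (- gamma)); apply: cvgM; [exact: cvg_cst|exact: v_cvg0].
- by move=> t t0; have := dv t0 => ?; apply: ex_derive.
- apply: cvg_at_right_filter; apply: cvgM; [exact: cvg_cst|exact: cv].
- move=> t; rewrite in_itv/= andbT => t0; rewrite derive1E.
  have := dv t0 => dvt.
  have := is_deriveZ (- gamma) dvt => -[_].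
  exact.
Qed.

End trajectory.

Lemma lyapunov_cost :
  asymptotically_stable_in f (ellipsoid P) /\
  forall x0 x, ellipsoid P x0 -> solution f x0 x ->
    (\int[lebesgue_measure]_(t in `[0%R, +oo[) (g (x t))%:E <= gamma%:E)%E.
Proof.
have V0 : V 0 = 0 by rewrite /V dot0l.
have VP y : (y^T *m P *m y) 0 0 = V y by rewrite /V /dot mulmxA.
have sub : ellipsoid P `<=` basin f.
  move=> x0; rewrite /ellipsoid/= VP => Vx0; split.
    exact: lipschitz_solution L0 f_lip.
  by move=> x xs; exact: trajectory_cvg0 xs Vx0.
have Vlt e : 0 < e -> \forall y \near (0 : 'cV[R]_n), V y < e.
  by move=> e0; apply: (@cvgr_lt _ _ _ _ V (V 0) (@cV 0)); rewrite V0.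
split; last first.
  by move=> x0 x; rewrite /ellipsoid/= VP => Vx0 xs; exact: trajectory_cost xs Vx0.
split=> //; split=> //.
- move=> e e0; have [c c0 hc] := posdef_coercive hP.
  (* The bound 1 keeps the trajectory in the ellipsoid; [c * e ^+ 2] becomes the norm bound [e] by
     coercivity. *)
  have m0 : 0 < Num.min 1 (c * e ^+ 2) by rewrite lt_min ltr01 mulr_gt0// exprn_gt0.
  have /nbhs_ballP[d /= d0 hd] := Vlt _ m0.
  exists d => // x0 x x0d xs t t0.
  have : V x0 < Num.min 1 (c * e ^+ 2).
    by apply: hd; rewrite -ball_normE/= sub0r normrN.
  rewrite lt_min => /andP[/ltW V1 Ve].
  rewrite -(@ltr_pXn2r _ 2%N) ?nnegrE// ?(ltW e0)//.
  apply: le_lt_trans (normrX2_le_dot _) _; rewrite -(ltr_pM2l c0).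
  apply: le_lt_trans (hc _) _; apply: le_lt_trans Ve.
  exact: (trajectory_form_le xs V1).
- apply: filterS (Vlt 1 ltr01) => y /ltW Vy; apply: sub.
  by rewrite /ellipsoid/= VP.
Qed.

End lyapunov.

(** * The closed loop *)

Section saturated_loop.
Variables (R : realType) (n m : nat) (ubar : 'cV[R]_m).
Hypothesis u0 : forall j, 0 < ubar j 0.

Lemma mulmx_norm_le p q (A : 'M[R]_(p, q)) :
  exists2 K, 0 < K & forall v : 'cV[R]_q, `|A *m v| <= K * `|v|.
Proof.
exists (1 + \sum_i \sum_j `|A i j|) => [|v].
  by rewrite ltr_pwDl// sumr_ge0// => i _; rewrite sumr_ge0.
apply/mxnorm_leP => [|i j].
  by rewrite mulr_ge0// addr_ge0// sumr_ge0// => i _; rewrite sumr_ge0.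
rewrite mulrDl mul1r; apply: ler_wpDl => //.
rewrite mxE (le_trans (ler_norm_sum _ _ _))// (bigD1 i)//= mulrDl.
apply: ler_wpDr.
  by rewrite mulr_ge0// sumr_ge0// => k _; rewrite sumr_ge0.
rewrite mulr_suml; apply: ler_sum => k _; rewrite normrM ler_wpM2l//.
exact: mx_entry_le.
Qed.

Lemma sat_norm_le s s' : `|sat ubar s - sat ubar s'| <= `|s - s'|.
Proof.
apply/mxnorm_leP => // i j; rewrite (ord1 j) mxE [(- sat _ _) i 0]mxE.
apply: le_trans (sat_lipschitz _ _ _) _ => //.
by have := mx_entry_le (s - s') i 0; rewrite !mxE.
Qed.

Lemma sat_continuous : continuous (sat ubar).
Proof.
apply: (lipschitz_continuous ltr01) => s s'; rewrite mul1r; exact: sat_norm_le.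
Qed.

Lemma sat_form_continuous (C : 'M[R]_(m, n)) (W : 'M[R]_m) :
  continuous (fun x => dot (sat ubar (C *m x)) (W *m sat ubar (C *m x))).
Proof.
move=> x.
have cC : C *m y @[y --> x] --> C *m x.
  exact: (@cvg_mulmx _ _ (nbhs x) _ _ _ C id x cvg_id).
have cs : sat ubar (C *m y) @[y --> x] --> sat ubar (C *m x).
  apply: (@cvg_comp _ _ _ (mulmx C) (sat ubar) (nbhs x) _ _ cC).
  exact: sat_continuous.
exact: (@cvg_dot _ _ (nbhs x) _ _ _ _ _ _ cs
  (@cvg_mulmx _ _ (nbhs x) _ _ _ W _ _ cs)).
Qed.

Lemma saturated_lipschitz (A : 'M[R]_n) (B : 'M[R]_(n, m)) (C : 'M[R]_(m, n)) :
  exists2 L, 0 < L & forall x y,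
    `|(A *m x + B *m deadzone ubar (C *m x))
      - (A *m y + B *m deadzone ubar (C *m y))| <= L * `|x - y|.
Proof.
have [a a0 hA] := mulmx_norm_le A; have [b b0 hB] := mulmx_norm_le B.
have [c c0 hC] := mulmx_norm_le C.
(* The factor 2 comes from the deadzone, a difference of two maps that are each 1-Lipschitz. *)
exists (a + b * (2 * c)) => [|x y]; first by rewrite addr_gt0// !mulr_gt0.
rewrite opprD addrACA -!mulmxBr (le_trans (ler_normD _ _))// mulrDl.
rewrite lerD// (le_trans (hB _))// -mulrA ler_pM2l//.
have -> : deadzone ubar (C *m x) - deadzone ubar (C *m y) =
    (sat ubar (C *m x) - sat ubar (C *m y)) - C *m (x - y).
  by rewrite /deadzone mulmxBr !opprB addrACA [RHS]addrACA [- (C *m x) - _]addrC.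
rewrite (le_trans (ler_normB _ _))// -mulrA mulr_natl mulr2n lerD//.
by rewrite (le_trans (sat_norm_le _ _))// -mulmxBr.
Qed.

End saturated_loop.
Theorem theorem3 (R : realType) (np nc nf q mc ma r : nat)
  (* dimensions *)
  (hma : (mc < ma)%N) (hnf : nf = (ma - mc)%N)
  (* saturation bounds *)
  (ubar : 'cV[R]_ma) (hubar : forall j, 0 < ubar j 0)
  (* uncertain influence matrix M(theta) = Mn + Mu(theta) *)
  (Theta : set 'cV[R]_r) (hTheta : convex_polytope Theta)
  (Mn : 'M[R]_(mc, ma)) (Mu : 'cV[R]_r -> 'M[R]_(mc, ma))
  (hM : forall theta, Theta theta -> row_free (Mn + Mu theta))
  (alpha : 'I_(2 ^ r) -> 'cV[R]_r -> R) (Mi : 'I_(2 ^ r) -> 'M[R]_(mc, ma))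
  (halpha0 : forall theta, Theta theta -> forall i, 0 <= alpha i theta)
  (halpha1 : forall theta, Theta theta -> \sum_i alpha i theta = 1)
  (hMu : forall theta, Theta theta -> Mu theta = \sum_i alpha i theta *: Mi i)
  (Mdag : 'M[R]_(ma, mc)) (hMdag : Mn *m Mdag = 1%:M)
  (N : 'M[R]_(ma, nf)) (hN : cols_basis_ker Mn N)
  (* plant, controller and weighting matrix *)
  (Ap : 'M[R]_np) (Bp : 'M[R]_(np, mc)) (Cp : 'M[R]_(q, np))
  (hctrl : controllable Ap Bp) (hobs : observable Cp Ap)
  (Ac : 'M[R]_nc) (Bc : 'M[R]_(nc, q)) (Cc : 'M[R]_(mc, nc))
  (Dc : 'M[R]_(mc, q))
  (W : 'M[R]_ma) (hWdiag : is_diag_mx W) (hW : posdef W)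
  (* closed-loop data *)
  (n := (np + nc + nf)%N)
  (A0 := block_mx (Ap + Bp *m Dc *m Cp) (Bp *m Cc) (Bc *m Cp) Ac
         : 'M[R]_(np + nc))
  (hA0 : hurwitz A0)
  (A := block_mx A0 0 0 0 : 'M[R]_n)
  (Bbar := col_mx (col_mx Bp 0) 0 : 'M[R]_(n, mc))
  (B := Bbar *m Mn)
  (C := row_mx (row_mx (Mdag *m Dc *m Cp) (Mdag *m Cc)) N : 'M[R]_(ma, n))
  (Cbar := N^T *m W *m C)
  (A_ := fun i => A + Bbar *m Mi i *m C)
  (B_ := fun i => B + Bbar *m Mi i)
  (Lc := (row_mx (row_mx 0 1%:M) 0)^T : 'M[R]_(n, nc))
  (Lf := (row_mx (row_mx 0 0) 1%:M)^T : 'M[R]_(n, nf))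
  (L := row_mx Lc Lf)
  (calA := fun theta => \sum_i alpha i theta *: A_ i)
  (calB := fun theta => \sum_i alpha i theta *: B_ i)
  (Cperp : 'M[R]_(n, np + nc)) (hCperp : Cbar *m Cperp = 0)
  (* decision variables *)
  (Pbar : 'I_(2 ^ r) -> 'M[R]_n) (hPbar : forall i, posdef (Pbar i))
  (Jo : 'M[R]_(np + nc)) (Jf : 'M[R]_(nf, n)) (Kbarf : 'M[R]_nf)
  (Ke : 'M[R]_(nc + nf, ma)) (Gbar : 'M[R]_(ma, n))
  (S : 'M[R]_ma) (hSdiag : is_diag_mx S) (hS : posdef S)
  (gamma : R) (hgamma : 0 < gamma)
  (Jbar := (row_mx (Cperp *m Jo^T) Jf^T)^T : 'M[R]_n)
  (Z := block_mx 0 0 0 Kbarf : 'M[R]_n)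
  (Psi12 := fun i => Pbar i + A_ i *m Jbar^T + Z - Jbar)
  (Psi13 := fun i => B_ i *m S + L *m Ke)
  (Psi22 := fun i => He (A_ i *m Jbar^T + Z))
  (Psi23 := fun i => Psi13 i - Gbar^T - Jbar *m C^T)
  (* matrix inequalities *)
  (hLMI1 : forall i, negdef
    (star_mx
      (star_mx (- Jbar - Jbar^T) (Psi12 i) (Psi22 i))
      (block_mx (Psi13 i) 0
                (Psi23 i) (Jbar *m C^T *m sqrt_diag W))
      (star_mx (- (2 *: S)) (S *m sqrt_diag W) (- gamma%:M))))
  (hLMI2 : forall i j, possemidef
    (star_mx (Pbar i) (row j Gbar)^T (ubar j 0 ^+ 2)%:M))
  (* gains and closed loop *)
  (E := Ke *m invmx S)
  (Kf := Kbarf *m invmx (Cbar *m Jf^T))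
  (closed_loop := fun theta (x : 'cV[R]_n) =>
     (calA theta + Lf *m Kf *m Cbar) *m x
     + (calB theta + L *m E) *m deadzone ubar (C *m x))
  (J := invmx Jbar)
  (P := fun theta => \sum_i alpha i theta *: (J *m Pbar i *m J^T)) :
  [/\ Jbar \in unitmx, Cbar *m Jf^T \in unitmx &
    forall theta, Theta theta ->
      asymptotically_stable_in (closed_loop theta) (ellipsoid (P theta)) /\
      forall x0 x, ellipsoid (P theta) x0 ->
        solution (closed_loop theta) x0 x ->
        (\int[lebesgue_measure]_(t in `[0%R, +oo[)
           (((sat ubar (C *m x t))^T *m W *m sat ubar (C *m x t)) 0 0)%:E
         <= gamma%:E)%E].

Proof.
(* [Cperp] removes the first block, so the product of [Kf] with this matrix involves only
   [Kf (Cbar Jf^T) = Kbarf]; this is the linearising change of variables. *)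
have rowJ : Cbar *m Jbar^T = row_mx 0 (Cbar *m Jf^T).
  by rewrite /Jbar trmxK mul_mx_row mulmxA hCperp mul0mx.
pose i0 : 'I_(2 ^ r) := Ordinal (expn_gt0 2 r).
have Ju : Jbar \in unitmx.
  (* The first inequality at [(v, 0, 0, 0)] makes the symmetric part of [Jbar] positive definite. *)
  apply: accretive_unitmx => v v0.
  have /posdefP[_ /(_ (col_mx (col_mx v 0) 0))] := hLMI1 i0.
  rewrite !col_mx_eq0 (negPf v0) => /(_ isT).
  rewrite mulNmx dotNr !dot_star_mx !mulmx0 !dot0r mulmxBl mulNmx.
  rewrite dotDr !dotNr (dot_trmx v Jbar v); lra.
have JTu : Jbar^T \in unitmx by rewrite unitmx_tr.
have Du : Cbar *m Jf^T \in unitmx.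
  (* By [rowJ] and invertibility of [Jbar], [u Cbar = 0]. Its last block is [u N^T W N = 0], so
     [N u^T = 0] as [W] is positive definite, and [u = 0] as the columns of [N] are independent. *)
  apply: unitmx_lker0 => u uD.
  have uC : u *m Cbar = 0.
    rewrite -(mulmxK JTu (u *m Cbar)) -(mulmxA u) rowJ mul_mx_row uD mulmx0.
    by rewrite row_mx0 mul0mx.
  have uNWN : u *m N^T *m W *m N = 0.
    move: uC; rewrite /Cbar /C !mulmxA !mul_mx_row -[RHS]row_mx0.
    by move=> /eq_row_mx[].
  have NuT : N *m u^T = 0.
    apply/eqP; apply: contraT => Nu0; case/posdefP: hW => _ /(_ _ Nu0).
    by rewrite /dot trmx_mul trmxK !mulmxA uNWN mul0mx mxE ltxx.
  have [Nfree _] := hN; apply: (row_free_inj Nfree); rewrite mul0mx.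
  by rewrite -[LHS]trmxK trmx_mul trmxK NuT trmx0.
split=> // theta Th.
have KfD : Kf *m (Cbar *m Jf^T) = Kbarf by rewrite mulmxKV.
have LfE : Lf *m Kf *m Cbar *m Jbar^T = Z.
  rewrite -[_ *m Cbar *m _]mulmxA rowJ mul_mx_row mulmx0 -[Lf *m Kf *m _]mulmxA KfD.
  rewrite /Lf tr_row_mx row_mx0 trmx0 trmx1 mul_col_mx mul0mx mul1mx.
  by rewrite /Z block_mxEh col_mx0.
have Su := posdef_unitmx hS.
have LE : L *m E *m S = L *m Ke by rewrite -mulmxA mulmxKV.
pose al i := alpha i theta.
have al0 i : 0 <= al i by exact: halpha0.
have al1 : \sum_i al i = 1 by exact: halpha1.
(* The gains are absorbed into the vertex matrices; since the weights sum to 1, averaging these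
   recovers the closed loop. *)
pose Acl i := A_ i + Lf *m Kf *m Cbar.
pose Bcl i := B_ i + L *m E.
have AE : calA theta + Lf *m Kf *m Cbar = \sum_i al i *: Acl i.
  rewrite /calA -{1}(convex_cst al1 (Lf *m Kf *m Cbar)) -big_split/=.
  by apply: eq_bigr => i _; rewrite -scalerDr.
have BE : calB theta + L *m E = \sum_i al i *: Bcl i.
  rewrite /calB -{1}(convex_cst al1 (L *m E)) -big_split/=.
  by apply: eq_bigr => i _; rewrite -scalerDr.
have AJ i : Acl i *m Jbar^T = A_ i *m Jbar^T + Z by rewrite [LHS]mulmxDl LfE.
have BS i : Bcl i *m S = B_ i *m S + L *m Ke by rewrite [LHS]mulmxDl LE.
have lmi i : negdef (star_mx
    (star_mx (- Jbar - Jbar^T) (Pbar i + Acl i *m Jbar^T - Jbar)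
             (He (Acl i *m Jbar^T)))
    (block_mx (Bcl i *m S) 0 (Bcl i *m S - Gbar^T - Jbar *m C^T)
              (Jbar *m C^T *m sqrt_diag W))
    (star_mx (- (2 *: S)) (S *m sqrt_diag W) (- gamma%:M))).
  by have := hLMI1 i; rewrite /Psi12 /Psi22 /Psi23 /Psi13 -[_ + _ + Z]addrA -AJ -BS.
have [k k0 hk] :=
  lmi_decay al0 al1 hubar Ju hgamma hSdiag hS hWdiag hW lmi hLMI2.
have [l l0 hl] := saturated_lipschitz hubar (\sum_i al i *: Acl i)
  (\sum_i al i *: Bcl i) C.
pose g x := dot (sat ubar (C *m x)) (W *m sat ubar (C *m x)).
have fE : closed_loop theta = fun x => (\sum_i al i *: Acl i) *m x
   + (\sum_i al i *: Bcl i) *m deadzone ubar (C *m x).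
  by apply/funext => x; rewrite /closed_loop AE BE.
have gE x : ((sat ubar (C *m x))^T *m W *m sat ubar (C *m x)) 0 0 = g x.
  by rewrite /g /dot mulmxA.
under eq_forall do (under eq_forall do under eq_integral do rewrite gE).
rewrite fE; apply: (lyapunov_cost l0 k0 hgamma hl _ _ _ _ hk).
- by rewrite !mulmx0 /deadzone sat0 subr0 mulmx0 addr0.
- by apply: posdef_convex => // i; apply: posdef_congr => //; rewrite unitmx_inv.
- move=> x; exact: (sat_form_continuous hubar).
- move=> x; have [->|s0] := eqVneq (sat ubar (C *m x)) 0; first by rewrite /g dot0l.
  by case/posdefP: hW => _ /(_ _ s0)/ltW.
Qed.
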